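(* (In ZFC.) There exists a Tychonoff countably compact topological semigroup containing a copy of the bicyclic semigroup.
   Context: A topological semigroup is a semigroup endowed with a topology for which the multiplication is (jointly) continuous. Tychonoff means completely regular and Hausdorff. A space is countably compact if every countable open cover has a finite subcover. The bicyclic semigroup $C(p,q)$ is the monoid generated by two elements $p$ and $q$ subject to the single relation $qp=1$; every element has a unique representation $p^nq^m$ with $n,m\in\mathbb N=\{0,1,2,\dots\}$. A copy of it in a semigroup is a subsemigroup isomorphic to $C(p,q)$. *)

(* Defs.v *)
From HB Require Import structures.
From mathcomp Require Import all_boot all_classical topology normedtype.

Set Implicit Arguments.
Unset Strict Implicit.
Unset Printing Implicit Defensive.

Local Open Scope classical_set_scope.
Local Open Scope quotient_scope.
Local Open Scope group_scope.

HB.structure Definition PreTopologicalSemigroup :=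
  {S of Topological S & Semigroup S}.

HB.mixin Record PreTopologicalSemigroup_isTopologicalSemigroup S
    of PreTopologicalSemigroup S := {
  mulg_continuous : continuous (fun x : S * S => x.1 * x.2)
}.

#[short(type="topologicalSemigroupType")]
HB.structure Definition TopologicalSemigroup :=
  {S of PreTopologicalSemigroup S &
        PreTopologicalSemigroup_isTopologicalSemigroup S}.

Definition tychonoff_space (T : topologicalType) : Prop :=
  completely_regular_space T /\ hausdorff_space T.

(* This is [cover_compact] restricted to countable families. *)
Definition countably_compact (T : topologicalType) (A : set T) : Prop :=
  forall (I : choiceType) (D : set I) (f : I -> set T), countable D ->
    (forall i, D i -> open (f i)) -> A `<=` cover D f ->
    finite_subset_cover D f A.

(* The free monoid on {p, q} is [seq bool] under concatenation. *)
Definition bicyclic_word := seq bool.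
Definition letter_p : bool := true.
Definition letter_q : bool := false.

(* The least monoid congruence identifying qp with the empty word. *)
Inductive bicyclic_cong : bicyclic_word -> bicyclic_word -> Prop :=
| bicyclic_cong_qp : bicyclic_cong [:: letter_q; letter_p] [::]
| bicyclic_cong_cat u u' v v' : bicyclic_cong u u' -> bicyclic_cong v v' ->
    bicyclic_cong (u ++ v) (u' ++ v')
| bicyclic_cong_refl u : bicyclic_cong u u
| bicyclic_cong_sym u v : bicyclic_cong u v -> bicyclic_cong v u
| bicyclic_cong_trans v u w :
    bicyclic_cong u v -> bicyclic_cong v w -> bicyclic_cong u w.

Definition bicyclic_congb : rel bicyclic_word :=
  fun u v => `[< bicyclic_cong u v >].

Lemma bicyclic_congb_refl : reflexive bicyclic_congb.
Proof. by move=> u; apply/asboolP; exact: bicyclic_cong_refl. Qed.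

Lemma bicyclic_congb_sym : symmetric bicyclic_congb.
Proof.
by move=> u v; apply/asboolP/asboolP => /bicyclic_cong_sym.
Qed.

Lemma bicyclic_congb_trans : transitive bicyclic_congb.
Proof.
move=> v u w /asboolP uv /asboolP vw; apply/asboolP.
exact: bicyclic_cong_trans uv vw.
Qed.

Canonical bicyclic_equiv :=
  EquivRel bicyclic_congb bicyclic_congb_refl bicyclic_congb_sym
    bicyclic_congb_trans.

Definition bicyclic := {eq_quot bicyclic_equiv}.

HB.instance Definition _ := Choice.on bicyclic.

Definition bicyclic_pi (u : bicyclic_word) : bicyclic := \pi_bicyclic u.

Lemma bicyclic_piP (x : bicyclic) : exists u, x = bicyclic_pi u.
Proof. by exists (repr x); rewrite /bicyclic_pi reprK. Qed.

Lemma eq_bicyclicP (u v : bicyclic_word) :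
  bicyclic_pi u = bicyclic_pi v <-> bicyclic_cong u v.
Proof.
split=> [/eqP|uv]; first by rewrite eqmodE => /asboolP.
by apply/eqP; rewrite eqmodE; apply/asboolP.
Qed.

Definition bicyclic_mul (x y : bicyclic) : bicyclic :=
  bicyclic_pi (repr x ++ repr y).

Lemma bicyclic_mul_pi (u v : bicyclic_word) :
  bicyclic_mul (bicyclic_pi u) (bicyclic_pi v) = bicyclic_pi (u ++ v).
Proof.
by apply/eq_bicyclicP; apply: bicyclic_cong_cat; apply/eq_bicyclicP;
  rewrite /bicyclic_pi reprK.
Qed.

Lemma bicyclic_mulA : associative bicyclic_mul.
Proof.
move=> x y z; have [u ->] := bicyclic_piP x; have [v ->] := bicyclic_piP y.
by have [w ->] := bicyclic_piP z; rewrite !bicyclic_mul_pi catA.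
Qed.

Lemma bicyclic_mul1 : left_id (bicyclic_pi [::]) bicyclic_mul.
Proof. by move=> x; have [u ->] := bicyclic_piP x; rewrite bicyclic_mul_pi. Qed.

Lemma bicyclic_mulr1 : right_id (bicyclic_pi [::]) bicyclic_mul.
Proof.
by move=> x; have [u ->] := bicyclic_piP x; rewrite bicyclic_mul_pi cats0.
Qed.

HB.instance Definition _ :=
  isMonoid.Build bicyclic bicyclic_mulA bicyclic_mul1 bicyclic_mulr1.

Lemma bicyclic_piM (u v : bicyclic_word) :
  bicyclic_pi (u ++ v) = bicyclic_pi u * bicyclic_pi v.
Proof. by rewrite -bicyclic_mul_pi. Qed.

Definition bicyclic_p : bicyclic := bicyclic_pi [:: letter_p].
Definition bicyclic_q : bicyclic := bicyclic_pi [:: letter_q].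

Lemma bicyclic_qp : bicyclic_q * bicyclic_p = 1.
Proof. by rewrite -bicyclic_piM; apply/eq_bicyclicP; exact: bicyclic_cong_qp. Qed.

Lemma bicyclic_XpXq (n m : nat) :
  bicyclic_p ^+ n * bicyclic_q ^+ m =
  bicyclic_pi (nseq n letter_p ++ nseq m letter_q).
Proof.
have powE (a : bool) k : (bicyclic_pi [:: a]) ^+ k = bicyclic_pi (nseq k a).
  by elim: k => [//|k IHk]; rewrite expgS IHk -bicyclic_piM.
by rewrite !powE bicyclic_piM.
Qed.

(* Left multiplication of p^n q^m, encoded as (n, m), by a letter. *)
Definition bicyclic_act (a : bool) (x : nat * nat) : nat * nat :=
  if a then (x.1.+1, x.2)
  else if x.1 is n.+1 then (n, x.2) else (0%N, x.2.+1).

Lemma bicyclic_act_cong (u v : bicyclic_word) : bicyclic_cong u v ->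
  forall x, foldr bicyclic_act x u = foldr bicyclic_act x v.
Proof.
elim=> //=; first by case.
- by move=> {}u u' {}v v' _ IHu _ IHv x; rewrite !foldr_cat IHu IHv.
- by move=> {}v {}u w _ IHu _ IHv x; rewrite IHu IHv.
Qed.

Lemma bicyclic_normal_form (x : bicyclic) :
  exists! nm : nat * nat, x = bicyclic_p ^+ nm.1 * bicyclic_q ^+ nm.2.
Proof.
have ex : exists nm : nat * nat, x = bicyclic_p ^+ nm.1 * bicyclic_q ^+ nm.2.
  have [u ->] := bicyclic_piP x.
  elim: u => [|a u [[n m] /= IHu]]; first by exists (0, 0)%N; rewrite mulg1.
  rewrite -cat1s bicyclic_piM IHu; case: a.
    by exists (n.+1, m); rewrite mulgA -expgS.
  case: n {IHu} => [|n]; first by exists (0, m.+1)%N; rewrite !mul1g expgS.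
  by exists (n, m); rewrite expgS !mulgA [X in X * _ * _]bicyclic_qp mul1g.
have actE (n m : nat) : foldr bicyclic_act (0, 0)%N
    (nseq n letter_p ++ nseq m letter_q) = (n, m).
  rewrite foldr_cat.
  have -> : foldr bicyclic_act (0, 0)%N (nseq m letter_q) = (0%N, m).
    by elim: m => //= m ->.
  by elim: n => //= n ->.
case: ex => -[n m] /= xE; exists (n, m); split=> // -[n' m'] /=.
rewrite xE !bicyclic_XpXq => /eq_bicyclicP/bicyclic_act_cong/(_ (0, 0)%N).
by rewrite !actE.
Qed.

Definition bicyclic_copy (S : semigroupType) (A : set S) : Prop :=
  (forall x y, A x -> A y -> A (x * y)) /\
  exists f : {multiplicative bicyclic -> S}, set_bij [set: bicyclic] A f.

(* Main.v *)
From HB Require Import structures.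
Require Import Defs.
From mathcomp Require Import all_boot all_order all_algebra all_classical.
From mathcomp Require Import all_reals topology normedtype.
From mathcomp Require Import complex Rstruct zify ring lra.

Set Implicit Arguments.
Unset Strict Implicit.
Unset Printing Implicit Defensive.

Import numFieldNormedType.Exports.
Import Order.TTheory GRing.Theory Num.Theory.

Local Open Scope classical_set_scope.
Local Open Scope ring_scope.

(** Why such a semigroup exists.  Let h map p^n q^m to n - m.  Every fibre of h
    is infinite, so in a countably compact semigroup it must accumulate; here
    the elements of the fibre over z that leave all finite sets converge to a
    copy of the integer z.  The semigroup is thus the union of the bicyclic
    monoid, of a discrete copy of the integers glued to it in this way, and of
    an ideal Y that provides the accumulation points of all other sequences.
    Modulo the fibres, Z and Y sit in a commutative semigroup of functions into
    the unit circle.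

    Continuity of the product comes down to Y being disjoint from Z.  A product
    x y with a factor in Y lies in Y, hence it differs from each integer z, and
    the products of points close to x and y stay out of the fibre over z
    ([near_fibre_mul]).  In particular q^n and p^n, with product 1 in the
    fibre over 0, cannot accumulate jointly at points x and y of Y.

    The elements of Y are formal.  A term is built from integers, sums and
    limits [tlim f] of double sequences f of terms; it lies in Y when it
    mentions a limit.  Two terms are identified when all [admissible]
    characters agree on them.  A character is admissible if its value at
    [tlim f] is the limit of its values at the f n k, along an ultrafilter
    attached to f, for each f that is dissociated: at each level n, the vectors
    of the f n k satisfy no nontrivial relation with coefficients below a bound
    fixed in advance.  In a torsion-free group each sequence that takes
    infinitely many values has a dissociated subsequence
    ([exists_dissociated_block]), so countable compactness is built in.

    What has to be proved is that Y and Z remain disjoint after the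
    identification ([separation]): a term t with a limit is not 1 at some
    admissible character.  Only the countably many limits hidden in t matter,
    since a character of these extends to all others by taking limits
    ([exists_admissible_extension]).  The sets of levels [levels f] are almost
    disjoint for distinct f, so each level n may be assigned to one of these
    countably many limits.  The requirement at level n is that the character be
    close to 1 at the vectors f n k - tlim f, except for a few k that the
    ultrafilter of f ignores.  The number of exceptions needed is bounded by
    the number of pairs of coefficient vectors of the previous levels, hence is
    known in advance, and level n is chosen much larger than that.  Removing
    one vector for each such pair leaves a family without small relations ([dissociated_prune]).  For a finite family without small
    relations, a character close to 1 on it and far from 1 at t is found by
    averaging over a finite group ([almost_trivial_char]); an ultrafilter limit
    of these characters satisfies all the requirements together. *)

(** * Compactness of the unit disc *)

Lemma ultra_cvg_compact (X : Type) (T : topologicalType) (A : set T)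
    (G : set_system X) (u : X -> T) : compact A -> UltraFilter G ->
  (\forall i \near G, A (u i)) -> exists l : T, u @ G --> l.
Proof.
move=> cpt GU uA; have GP := @ultra_proper _ _ GU.
have [|l [_ ul]] := cpt (u @ G) _; first exact: uA.
exists l => W Wl; have [//|nW] := in_ultra_setVsetC (u @^-1` W) GU.
by have [z [/= nWz Wz]] := ul (~` W) W nW Wl.
Qed.

Lemma cvg_norm_le (C : numClosedFieldType) (T : Type) (G : set_system T)
    (u : T -> C) (l r : C) : ProperFilter G -> r \is Num.real ->
  u @ G --> l -> (\forall i \near G, `|u i| <= r) -> `|l| <= r.
Proof.
move=> GP rR ul ur; rewrite real_leNgt ?normr_real //; apply/negP => rl.
have /cvgrPdist_lt/(_ (`|l| - r)) := ul; rewrite subr_gt0 => /(_ rl) nl.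
have [i [li ui]] := @filter_ex _ _ GP _ (filterI nl ur).
have := ler_normD (l - u i) (u i); rewrite subrK => /le_lt_trans.
move=> /(_ `|l|); rewrite ltxx => H; apply: notF; apply: H.
by rewrite -(subrK r `|l|); apply: ltr_leD.
Qed.

(** The reduction to real coordinates is all that is specific to the complex
    numbers: what follows holds over each algebraically closed field with a
    compact unit disc. *)
Lemma compact_disc_coordinates (C : numClosedFieldType) (R : realType)
    (re im : C -> R) (mk : R -> R -> C) :
    (forall z, `|z| <= 1 -> `|re z| <= 1 /\ `|im z| <= 1) ->
    (forall e : C, 0 < e -> exists2 d : R, 0 < d &
       forall z a b, `|a - re z| < d -> `|b - im z| < d -> `|mk a b - z| < e) ->
  compact [set z : C | `|z| <= 1].
Proof.
move=> reim mkP F FP F1.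
have [G [GU FG]] := ultraFilterLemma FP; have GP := @ultra_proper _ _ GU.
have G1 := FG _ F1.
have cvgR (u : C -> R) : (forall z, `|z| <= 1 -> `|u z| <= 1) -> exists a : R, u @ G --> a.
  move=> u1; apply: (ultra_cvg_compact (@segment_compact R (-1) 1) GU).
  apply: (@filterS _ G _ _ _ _ G1) => z /u1.
  by rewrite ler_norml /= in_itv.
have [a rea] := cvgR re (fun z z1 => (reim z z1).1).
have [b imb] := cvgR im (fun z z1 => (reim z z1).2).
have Gl : id @ G --> mk a b.
  apply/cvgrPdist_lt => e /mkP[d d0 dP].
  move/cvgrPdist_lt/(_ _ d0) : rea => rea; move/cvgrPdist_lt/(_ _ d0) : imb => imb.
  by apply: (@filterS _ G _ _ _ _ (filterI rea imb)) => z [/= ha hb]; exact: dP.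
exists (mk a b); split; first by apply: (cvg_norm_le GP _ Gl G1); rewrite rpred1.
move=> A B FA /Gl GB.
exact: (@filter_ex _ G GP _ (filterI (FG _ FA) GB)).
Qed.

Lemma compact_complex_disc (R : realType) :
  compact [set z : (complex R : numClosedFieldType) | `|z| <= 1].
Proof.
apply: (@compact_disc_coordinates _ R (@complex.Re R) (@complex.Im R) (fun a b => Complex a b)).
  case=> x y; rewrite normc_def lecE /= => /andP[_ le1].
  have : x ^+ 2 + y ^+ 2 <= 1.
    by move: le1; rewrite -[X in _ <= X]sqrtr1 ler_sqrt.
  rewrite -[`|x| <= 1]ler_sqr ?nnegrE // -[`|y| <= 1]ler_sqr ?nnegrE //.
  by rewrite !real_normK ?num_real // expr1n => h;
    split; apply: le_trans h; rewrite ?lerDl ?lerDr sqr_ge0.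
case=> e f; rewrite ltcE /= => /andP[/eqP -> e0]; exists (e / 2); first by rewrite divr_gt0.
case=> x y a b /= xa yb; rewrite normc_def ltcE /= eqxx /=.
have sq (c : R) : `|c| < e / 2 -> c ^+ 2 < (e / 2) ^+ 2.
  by move=> ce; rewrite -real_normK ?num_real // ltrXn2r // ?nnegrE // divr_ge0 // ltW.
rewrite -(ger0_norm (ltW e0)) -sqrtr_sqr ltr_sqrt ?exprn_gt0 //.
have := sq _ xa; have := sq _ yb; have := exprn_gt0 2 e0.
nra.
Qed.

(** * Orthogonality of finite characters *)

(** Iterated square roots of -1: if w^(2^m) = -1, the order of w divides
    2^(m+1) and not 2^m. *)
Lemma exists_prim_root_exp2 (C : numClosedFieldType) (m : nat) :
  exists w : C, (2 ^ m.+1)%N.-primitive_root w.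
Proof.
pose w : C := iter m (fun z : C => sqrtC z) (-1).
have wE : w ^+ (2 ^ m) = -1.
  rewrite /w; elim: m {w} => [|m IH]; first by rewrite expr1.
  by rewrite iterS expnS exprM sqrtCK.
exists w.
have w1 : w ^+ (2 ^ m.+1) = 1 by rewrite expnSr exprM wE sqrrN expr1n.
have [k kw kd] := prim_order_exists (n := 2 ^ m.+1) (expn_gt0 2 m.+1) w1.
have /(dvdn_pfactor _ _ (isT : prime 2)) [j jm kE] := kd.
move: jm; rewrite leq_eqVlt => /orP[/eqP <-|jm]; first by rewrite -kE.
have : w ^+ (2 ^ m) = 1.
  have /dvdnP [q ->] : (k %| 2 ^ m)%N by rewrite kE dvdn_exp2l.
  by rewrite mulnC exprM (prim_expr_order kw) expr1n.
rewrite wE => /eqP; rewrite eq_sym -subr_eq0 opprK.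
by rewrite -(natrD _ 1 1) pnatr_eq0.
Qed.

(** The value at the vector h of the character of the free abelian group on X
    that maps x to a x; F stands for a finite support of h. *)
Definition char_of (C : numClosedFieldType) (X : eqType) (F : seq X)
  (a : X -> C) (h : X -> int) : C := \prod_(x <- F) a x ^ h x.

Lemma norm_char_of (C : numClosedFieldType) (X : eqType) (F : seq X)
    (a : X -> C) (h : X -> int) : (forall x, `|a x| = 1) ->
  `|char_of F a h| = 1.
Proof.
move=> a1; rewrite normr_prod big1 // => x _.
by case: (h x) => n; rewrite -?exprnN -?exprnP ?normfV normrX a1 expr1n ?invr1.
Qed.

Lemma sum_root_unity (C : numClosedFieldType) (Q : nat) (w : C) (d : int) :
  Q.-primitive_root w -> (`|d| < Q)%N ->
  \sum_(k < Q) (w ^ d) ^+ k = (if d == 0 then Q%:R else 0).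
Proof.
move=> wQ dQ; case: eqP => [->|/eqP d0].
  rewrite expr0z (eq_bigr (fun=> 1)); last by move=> i _; rewrite expr1n.
  by rewrite sumr_const card_ord.
have zQ : (w ^ d) ^+ Q = 1.
  by rewrite exprnP exprz_exp mulrC -exprz_exp -exprnP (prim_expr_order wQ) exp1rz.
have z1 : w ^ d != 1.
  apply/eqP => z1; have : w ^+ `|d|%N = 1.
    case: d d0 dQ z1 {zQ} => n //= _ _; rewrite NegzE -exprnN => /(congr1 GRing.inv).
    by rewrite invrK invr1.
  move/eqP; rewrite -(prim_order_dvd wQ) => /dvdn_leq.
  by rewrite absz_gt0 leqNgt dQ => /(_ d0).
have := subrX1 (w ^ d) Q; rewrite zQ subrr => /esym/eqP.
by rewrite mulf_eq0 subr_eq0 (negbTE z1) => /eqP.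
Qed.

(** Characters with values in the roots of unity of order Q = 2^(m+1), for Q
    larger than twice the coordinates at stake: vectors of H that agree modulo
    Q are then equal, so that orthogonality modulo Q is orthogonality. *)
Lemma char_orthogonality (C : numClosedFieldType) (X : eqType) (F : seq X)
    (H : seq (X -> int)) : uniq F ->
    (forall h, h \in H -> forall x, x \notin F -> h x = 0) ->
  exists (A : finType) (a : A -> X -> C),
    [/\ (0 < #|A|)%N, forall i x, `|a i x| = 1 &
     forall h h', h \in H -> h' \in H ->
       \sum_i char_of F (a i) h * (char_of F (a i) h')^* =
       #|A|%:R * (h == h')%:R].
Proof.
move=> uF supp.
pose B := (\max_(h <- H) \max_(x <- F) `|h x|%N)%N.
have hB h x : h \in H -> x \in F -> (`|h x| <= B)%N.
  move=> hH xF; rewrite /B.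
  apply: leq_trans (leq_bigmax_seq h hH isT) => /=.
  exact: leq_bigmax_seq.
pose m := (2 * B)%N; pose Q := (2 ^ m.+1)%N.
have BQ : (2 * B < Q)%N.
  by apply: leq_trans (ltn_expl m (ltnSn 1)) _; rewrite /Q expnS leq_pmull.
have [w wQ] := exists_prim_root_exp2 C m; rewrite -/Q in wQ.
have Q0 : (0 < Q)%N by rewrite expn_gt0.
have w1 : `|w| = 1.
  have := congr1 Num.norm (prim_expr_order wQ).
  by rewrite normrX normr1 => /eqP; rewrite pexpr_eq1 // => /eqP.
pose a (i : {ffun 'I_(size F) -> 'I_Q}) (x : X) : C :=
  if insub (index x F) is Some j then w ^+ i j else 1.
exists {ffun 'I_(size F) -> 'I_Q}, a; split.
- by rewrite card_ffun !card_ord expn_gt0 Q0.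
- by move=> i x; rewrite /a; case: insub => [j|]; rewrite ?normrX ?w1 ?expr1n ?normr1.
move=> h h' hH h'H.
pose d (j : 'I_(size F)) := h (tnth (in_tuple F) j) - h' (tnth (in_tuple F) j).
have dB j : (`|d j| < Q)%N.
  apply: leq_ltn_trans BQ; rewrite mul2n -addnn.
  have xF := mem_tnth j (in_tuple F).
  by apply: leq_trans (leq_add (hB h _ hH xF) (hB h' _ h'H xF)); rewrite /d; lia.
have tE (i : {ffun 'I_(size F) -> 'I_Q}) :
    char_of F (a i) h * (char_of F (a i) h')^* = \prod_j (w ^ d j) ^+ i j.
  rewrite /char_of rmorph_prod -big_split /= big_tnth; apply: eq_bigr => j _.
  rewrite /a; have -> : insub (index (tnth (in_tuple F) j) F) = Some j :> option 'I_(size F).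
    by rewrite (tnth_nth (tnth (in_tuple F) j)) /= index_uniq // valK.
  have n1 : `|w ^+ i j| = 1 by rewrite normrX w1 expr1n.
  have n0 : w ^+ i j != 0 by rewrite -normr_eq0 n1 oner_eq0.
  rewrite /d; set u := h _; set v := h' _.
  have -> : ((w ^+ i j) ^ v)^* = ((w ^+ i j)^*) ^ v.
    by case: v => n; rewrite ?rmorphXn //= ?NegzE -?exprnN ?fmorphV ?rmorphXn.
  have -> : (w ^+ i j)^* = (w ^+ i j)^-1.
    by apply: (mulfI n0); rewrite mulfV // -normCK n1 expr1n.
  by rewrite exprz_inv -expfzDr // exprnP exprz_exp exprnP exprz_exp mulrC.
under eq_bigr => i _ do rewrite tE.
rewrite -(bigA_distr_bigA (fun j k => (w ^ d j) ^+ val k)) /=.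
under eq_bigr => j _ do rewrite (sum_root_unity wQ (dB j)).
case: eqP => [hh'|/eqP hh'].
  rewrite mulr1 card_ffun !card_ord (eq_bigr (fun=> Q%:R)); last first.
    by move=> j _; rewrite /d hh' subrr eqxx.
  by rewrite prodr_const card_ord natrX.
rewrite mulr0; apply/eqP/negPn/negP => /prodf_neq0 P0; case/eqP: hh'.
apply/funext => x; have [xF|xF] := boolP (x \in F); last by rewrite !supp.
have jF : (index x F < size F)%N by rewrite index_mem.
have := P0 (Ordinal jF) isT; rewrite /d (tnth_nth x) /= nth_index // subr_eq0.
by case: (h x =P h' x) => // _; rewrite eqxx.
Qed.

(** * Dissociated families and Parseval's identity *)

(** The sums of the v i with coefficients below M i, listed with
    multiplicity: uniqueness of the list says that these sums are distinct. *)
Fixpoint box (V : zmodType) (I : Type) (v : I -> V) (M : I -> nat) (s : seq I)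
    : seq V :=
  if s is i :: s' then [seq v i *+ j + h | j <- iota 0 (M i), h <- box v M s']
  else [:: 0].

(** Absence of small relations; working with two families of natural
    coefficients avoids signs. *)
Definition dissociated (V : zmodType) (I : eqType) (v : I -> V) (M : I -> nat)
    (s : seq I) :=
  forall c d : I -> nat,
    {in s, forall i, (c i < M i)%N /\ (d i < M i)%N} ->
    \sum_(i <- s) v i *+ c i = \sum_(i <- s) v i *+ d i -> {in s, c =1 d}.

Lemma size_box (V : zmodType) (I : Type) (v : I -> V) (M : I -> nat)
  (s : seq I) : size (box v M s) = (\prod_(i <- s) M i)%N.
Proof.
elim: s => [|i s IH]; first by rewrite big_nil.
by rewrite /= size_allpairs size_iota IH big_cons.
Qed.

Lemma mem_boxP (V : zmodType) (I : eqType) (v : I -> V) (M : I -> nat)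
    (s : seq I) (h : V) : uniq s ->
  reflect (exists2 c : I -> nat, {in s, forall i, (c i < M i)%N} &
             h = \sum_(i <- s) v i *+ c i) (h \in box v M s).
Proof.
elim: s h => [|i s IH] h.
  move=> _; rewrite inE; apply: (iffP eqP) => [->|[c _ ->]]; last by rewrite big_nil.
  by exists (fun=> 0%N) => //; rewrite big_nil.
move=> /= /andP[nis us].
apply: (iffP allpairsP) => [[[j h'] /= [+ /(IH h' us)[c cM ->] ->]]|[c cM ->]].
  rewrite mem_iota add0n => jM; exists (fun k => if k == i then j else c k).
    by move=> k; rewrite inE; case: eqP => [->|_] //= /cM.
  rewrite big_cons eqxx; congr (_ + _); apply: eq_big_seq => k ks.
  by case: eqP nis ks => // -> /negP.
exists (c i, \sum_(k <- s) v k *+ c k); rewrite big_cons mem_iota add0n.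
split=> //=; first by apply: cM; rewrite mem_head.
by apply/IH => //; exists c => // k ks; apply: cM; rewrite inE ks orbT.
Qed.

(** A coefficient family on s extends by zero at i. *)
Lemma dissociated_cons (V : zmodType) (I : eqType) (v : I -> V) (M : I -> nat)
    (i : I) (s : seq I) : (0 < M i)%N -> i \notin s ->
  dissociated v M (i :: s) -> dissociated v M s.
Proof.
move=> Mi nis free c d cd E.
pose z (c : I -> nat) k := if k == i then 0%N else c k.
have zE e : {in s, z e =1 e}.
  by move=> k ks; rewrite /z; case: eqP nis ks => // -> /negP.
have zS e : \sum_(k <- i :: s) v k *+ z e k = \sum_(k <- s) v k *+ e k.
  by rewrite big_cons {1}/z eqxx add0r; apply: eq_big_seq => k /zE ->.
move=> k ks; rewrite -(zE c) // -(zE d) //; apply: free; rewrite ?zS //.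
  move=> l; rewrite inE /z; case: eqP => [->|_] //= /cd //.
by rewrite inE ks orbT.
Qed.

Lemma uniq_box (V : zmodType) (I : eqType) (v : I -> V) (M : I -> nat)
    (s : seq I) : (forall i, 0 < M i)%N -> uniq s ->
  dissociated v M s -> uniq (box v M s).
Proof.
move=> M0; elim: s => [|i s IH] //= /andP[nis us] free.
have fs : dissociated v M s by apply: dissociated_cons free.
apply: allpairs_uniq; rewrite ?iota_uniq ?IH //.
move=> [j h] [j' h'] /allpairsP[[k l] /= [+ lS [-> ->]]].
rewrite mem_iota add0n => kM.
move=> /allpairsP[[k' l'] /= [+ l'S [-> ->]]].
rewrite mem_iota add0n => k'M E.
have [/(mem_boxP _ _ _ us)[c cM cE] /(mem_boxP _ _ _ us)[d dM dE]] := conj lS l'S.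
pose z j (c : I -> nat) k := if k == i then j else c k.
have zE j0 e : {in s, z j0 e =1 e}.
  by move=> m ms; rewrite /z; case: eqP nis ms => // -> /negP.
have zS j0 e : \sum_(k <- i :: s) v k *+ z j0 e k = v i *+ j0 + \sum_(k <- s) v k *+ e k.
  by rewrite big_cons {1}/z eqxx; congr (_ + _); apply: eq_big_seq => m /zE ->.
have F : {in i :: s, z k c =1 z k' d}.
  apply: free; last by rewrite !zS -cE -dE.
  move=> m; rewrite inE /z; case: eqP => [->|_] //= ms; split; [exact: cM|exact: dM].
have /= := F i (mem_head _ _); rewrite /z eqxx => <-; congr (_, _).
rewrite cE dE; apply: eq_big_seq => m ms.
by have := F m; rewrite inE ms orbT !zE // => ->.
Qed.

Lemma char_ofD (C : numClosedFieldType) (X : eqType) (F : seq X)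
    (a : X -> C) (g h : X -> int) : (forall x, `|a x| = 1) ->
  char_of F a (g + h) = char_of F a g * char_of F a h.
Proof.
move=> a1; rewrite /char_of -big_split /=; apply: eq_bigr => x _.
by rewrite expfzDr // -normr_eq0 a1 oner_eq0.
Qed.

Lemma char_ofMn (C : numClosedFieldType) (X : eqType) (F : seq X)
    (a : X -> C) (h : X -> int) n : (forall x, `|a x| = 1) ->
  char_of F a (h *+ n) = char_of F a h ^+ n.
Proof.
move=> a1; elim: n => [|n IH]; last by rewrite mulrS char_ofD // IH exprS.
by rewrite /char_of big1 // => x _; rewrite mulr0n expr0z.
Qed.

(** Summing a character over a box factors into geometric sums. *)
Lemma sum_box_char (C : numClosedFieldType) (X : eqType) (F : seq X)
    (a : X -> C) (I : Type) (v : I -> X -> int) (M : I -> nat) (s : seq I) :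
    (forall x, `|a x| = 1) ->
  \sum_(h <- box v M s) char_of F a h =
  \prod_(i <- s) \sum_(j < M i) char_of F a (v i) ^+ j.
Proof.
move=> a1; elim: s => [|i s IH] /=.
  by rewrite big_nil big_seq1 -(mulr0n 0) char_ofMn // expr0.
rewrite big_allpairs_dep big_cons -IH big_distrl /=.
rewrite -[X in _ = X](big_mkord xpredT (fun j => char_of F a (v i) ^+ j * _)) /index_iota subn0.
apply: eq_bigr => j _; rewrite big_distrr /=; apply: eq_bigr => h _.
by rewrite char_ofD // char_ofMn.
Qed.

Lemma parseval (C : numClosedFieldType) (V : zmodType) (A : finType)
    (psi : A -> V -> C) (H : seq V) : uniq H ->
    (forall h h', h \in H -> h' \in H ->
       \sum_i psi i h * (psi i h')^* = #|A|%:R * (h == h')%:R) ->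
  \sum_i `|\sum_(h <- H) psi i h| ^+ 2 = (#|A| * size H)%:R.
Proof.
move=> uH ort.
under eq_bigr => i _ do rewrite normCK rmorph_sum big_distrlr /=.
rewrite exchange_big /=.
transitivity (\sum_(h <- H) #|A|%:R : C); last first.
  by rewrite big_const_seq count_predT iter_addr_0 mulrnA.
apply: eq_big_seq => h hH; rewrite exchange_big /= (bigD1_seq h) //= ort // eqxx mulr1.
rewrite big_seq_cond big1 ?addr0 // => h' /andP[h'H hh'].
by rewrite ort // eq_sym (negbTE hh') mulr0.
Qed.

(** A finite form of Kronecker's theorem.  Average over the characters psi of
    a finite group with weight P = prod_(k in s) |S k|^2, where
    S k = sum_(j < M k) psi (v k)^j.  By Parseval the absence of small
    relations gives the mean of P, and also that of P |1 + psi (v i0)|^2, hence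
    the weighted mean of |1 - psi (v i0)|^2 is 2.  On the other hand
    (1 - psi (v k)) S k = 1 - psi (v k)^(M k) has norm at most 2, so that the
    weighted mean of |1 - psi (v k)|^2 is at most 4 / M k.  With
    sum_k lam k 4 / M k <= 1 some character has
    |1 - psi (v i0)|^2 >= 1 + sum_k lam k |1 - psi (v k)|^2. *)
Lemma almost_trivial_char (C : numClosedFieldType) (X : eqType) (F : seq X)
    (I : eqType) (v : I -> X -> int) (M : I -> nat) (lam : I -> C) (i0 : I)
    (s : seq I) : uniq F ->
    (forall i, i \in i0 :: s -> forall x, x \notin F -> v i x = 0) ->
    uniq (i0 :: s) -> dissociated v M (i0 :: s) ->
    (forall i, 0 < M i)%N -> M i0 = 2%N -> (forall i, 0 <= lam i) ->
    \sum_(i <- s) lam i * 4 / (M i)%:R <= 1 ->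
  exists a : X -> C, [/\ forall x, `|a x| = 1,
    1 <= `|1 - char_of F a (v i0)| ^+ 2 &
    {in s, forall i, lam i * `|1 - char_of F a (v i)| ^+ 2 <= 3}].
Proof.
move=> uF supp us free M0 Mi0 lam0 lam1.
have suppbox h : h \in box v M (i0 :: s) -> forall x, x \notin F -> h x = 0.
  case/(mem_boxP _ _ _ us) => c _ -> x xF.
  rewrite (@big_morph _ _ (fun g : X -> int => g x) 0 +%R) //.
  rewrite big1_seq // => i /andP[_ iS].
  suff -> : forall n, (v i *+ n) x = v i x *+ n by rewrite supp // mul0rn.
  by elim=> [|n IH]; rewrite ?mulr0n // !mulrS -IH.
have [A [a [A0 a1 ort]]] := char_orthogonality C uF suppbox.
pose psi i := char_of F (a i).
pose S i k : C := \sum_(j < M k) psi i (v k) ^+ j.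
have psi1 i h : `|psi i h| = 1 by exact: norm_char_of.
have mean r : subseq r (i0 :: s) ->
    \sum_(i : A) `|\prod_(k <- r) S i k| ^+ 2 = #|A|%:R * \prod_(k <- r) (M k)%:R.
  move=> rs.
  have ur : uniq r := subseq_uniq rs us.
  have sumE (G : I -> X -> int) :
      \sum_(k <- r) G k = \sum_(k <- i0 :: s) if k \in r then G k else 0.
    by rewrite -big_mkcond -big_filter; congr (\sum_(k <- _) _); exact/subseq_uniqP.
  have fr : dissociated v M r.
    move=> c d cd E.
    pose z (c : I -> nat) k := if k \in r then c k else 0%N.
    have zS e : \sum_(k <- i0 :: s) v k *+ z e k = \sum_(k <- r) v k *+ e k.
      by rewrite sumE; apply: eq_bigr => k _; rewrite /z; case: ifP.
    move=> k kr; have : z c k = z d k; last by rewrite /z kr.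
    apply: free; rewrite ?zS //; last exact: mem_subseq rs _ kr.
    by move=> l ls; rewrite /z; case: ifP => // /cd.
  have rsub : {subset box v M r <= box v M (i0 :: s)}.
    move=> h /(mem_boxP _ _ _ ur)[c cM ->]; apply/mem_boxP => //.
    exists (fun k => if k \in r then c k else 0%N).
      by move=> k _; case: ifP => // /cM.
    by rewrite sumE; apply: eq_bigr => k _; case: ifP.
  rewrite (eq_bigr (fun i => `|\sum_(h <- box v M r) psi i h| ^+ 2)); last first.
    by move=> i _; rewrite sum_box_char.
  rewrite (parseval (uniq_box M0 ur fr)); last first.
    by move=> h h' /rsub hr /rsub h'r; exact: ort.
  by rewrite natrM size_box natr_prod.
pose P i := `|\prod_(k <- s) S i k| ^+ 2.
pose Mt : C := \prod_(k <- s) (M k)%:R.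
have Mt0 : 0 < Mt by rewrite /Mt; elim/big_ind: _ => // *; rewrite ?mulr_gt0 // ltr0n.
have E0 : \sum_i P i = #|A|%:R * Mt by apply: mean; exact: subseq_cons.
have Et : \sum_i P i * `|1 - psi i (v i0)| ^+ 2 = #|A|%:R * Mt * 2.
  have E1 : \sum_i P i * `|1 + psi i (v i0)| ^+ 2 = #|A|%:R * Mt * 2.
    have := mean _ (subseq_refl _); rewrite big_cons Mi0 mulrCA mulrC => <-.
    apply: eq_bigr => i _; rewrite big_cons normrM exprMn mulrC; congr (_ ^+ 2 * _).
    by rewrite /S Mi0 !big_ord_recl big_ord0 addr0 expr0 expr1.
  have /(congr1 (fun z => z - #|A|%:R * Mt * 2)) : #|A|%:R * Mt * 4 = #|A|%:R * Mt * 4 by [].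
  rewrite -{1}E0 -{1}E1 mulr_suml -sumrB -mulrBr.
  have -> : 4 - 2 = 2 :> C by rewrite -(natrB _ (isT : 2 <= 4)%N).
  move=> <-; apply: eq_bigr => i _; rewrite -mulrBr; congr (_ * _).
  rewrite !normCK !rmorphB !rmorphD /= !rmorph1.
  have z1 : psi i (v i0) * (psi i (v i0))^* = 1 by rewrite -normCK psi1 expr1n.
  set z := psi _ _ in z1 *; rewrite !(mulrBr, mulrBl, mulrDl, mulrDr) z1.
  by ring.
have Ev k : k \in s ->
    \sum_i P i * `|1 - psi i (v k)| ^+ 2 <= #|A|%:R * Mt * (4 / (M k)%:R).
  move=> ks; have us' : uniq s by case/andP: us.
  have Mk0 : (M k)%:R != 0 :> C by rewrite pnatr_eq0 -lt0n.
  have := mean (rem k s) (subseq_trans (rem_subseq _ _) (subseq_cons _ _)).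
  have -> : Mt = (M k)%:R * \prod_(j <- rem k s) (M j)%:R.
    by rewrite /Mt (perm_big _ (perm_to_rem ks)) big_cons.
  set Q := \prod_(j <- rem k s) (M j)%:R => EQ.
  have -> : #|A|%:R * ((M k)%:R * Q) * (4 / (M k)%:R) = #|A|%:R * Q * 4.
    by field.
  rewrite -EQ mulr_suml; apply: ler_sum => i _.
  rewrite /P (perm_big _ (perm_to_rem ks)) big_cons normrM exprMn mulrC mulrA.
  rewrite mulrC; apply: ler_wpM2l; first by rewrite exprn_ge0.
  rewrite -exprMn -normrM.
  have -> : (1 - psi i (v k)) * S i k = 1 - psi i (v k) ^+ M k.
    by rewrite -opprB mulNr -subrX1 opprB.
  have -> : 4 = 2 ^+ 2 :> C by rewrite -natrX.
  rewrite lerXn2r ?nnegrE //; apply: le_trans (ler_normB _ _) _.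
  by rewrite normrX psi1 expr1n normr1.
(* P i * f i has a nonnegative sum, so f is nonnegative somewhere. *)
pose f i := `|1 - psi i (v i0)| ^+ 2 - 1 - \sum_(k <- s) lam k * `|1 - psi i (v k)| ^+ 2.
have Ef : 0 <= \sum_i P i * f i.
  under eq_bigr => i _ do rewrite mulrBr mulrBr mulr1 mulr_sumr.
  rewrite !sumrB Et E0 exchange_big /= subr_ge0.
  have -> : #|A|%:R * Mt * 2 - #|A|%:R * Mt = #|A|%:R * Mt * 1 by ring.
  apply: le_trans (ler_wpM2l _ lam1); last by rewrite mulr_ge0 // ltW.
  rewrite mulr_sumr ![X in X <= _]big_seq ![X in _ <= X]big_seq.
  apply: ler_sum => k ks.
  under eq_bigr => i _ do rewrite mulrCA.
  rewrite -mulr_sumr -mulrA mulrCA ler_wpM2l //; exact: Ev.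
have fR i : f i \is Num.real.
  rewrite /f !rpredB ?rpred1 ?rpredX ?normr_real //.
  by apply: rpred_sum => k _; rewrite rpredM ?rpredX ?normr_real ?ger0_real.
have [i fi] : exists i, 0 <= f i.
  apply: contrapT => /forallNP nf.
  have fneg i : f i < 0 by rewrite real_ltNge ?real0 //; apply/negP/nf.
  have P0 i : 0 <= P i by rewrite exprn_ge0.
  have : \sum_i P i * - f i = 0.
    apply/eqP; rewrite eq_le; apply/andP; split.
      by under eq_bigr => i _ do rewrite mulrN; rewrite sumrN oppr_le0.
    by apply: sumr_ge0 => i _; rewrite mulr_ge0 // oppr_ge0 ltW.
  move=> /eqP; rewrite psumr_eq0; last first.
    by move=> i _; rewrite mulr_ge0 // oppr_ge0 ltW.
  move=> /allP Pz; move: E0; rewrite big1.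
    by move/esym/eqP; rewrite mulf_eq0 (gt_eqF Mt0) orbF pnatr_eq0 -leqn0 leqNgt A0.
  move=> i _; have := Pz i (mem_index_enum _); rewrite /= mulf_eq0 oppr_eq0.
  by rewrite (lt_eqF (fneg i)) orbF => /eqP.
have le4 k : `|1 - psi i (v k)| ^+ 2 <= 4.
  have -> : 4 = 2 ^+ 2 :> C by rewrite -natrX.
  rewrite lerXn2r ?nnegrE //; apply: le_trans (ler_normB _ _) _.
  by rewrite normr1 psi1.
have term0 k : 0 <= lam k * `|1 - psi i (v k)| ^+ 2 by rewrite mulr_ge0 // exprn_ge0.
have sum0 r : 0 <= \sum_(k <- r) lam k * `|1 - psi i (v k)| ^+ 2 by apply: sumr_ge0.
exists (a i); split => // [|k ks].
  by move: fi; rewrite /f subr_ge0 => /(le_trans (sum0 s)); rewrite subr_ge0.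
move: fi; rewrite /f subr_ge0 (big_rem _ ks) /= => fi.
apply: (@le_trans _ _ (`|1 - psi i (v i0)| ^+ 2 - 1)).
  by apply: le_trans fi; rewrite lerDl.
by rewrite lerBlDr (le_trans (le4 _)) // -(natrD _ 3 1).
Qed.

(** * Pruning a new level of relations *)

Lemma dissociated_perm (V : zmodType) (I : eqType) (v : I -> V) (M : I -> nat)
    (r s : seq I) : perm_eq r s -> dissociated v M r -> dissociated v M s.
Proof.
move=> rs fr c d cd E i; rewrite -(perm_mem rs); apply: fr => [j|].
  by rewrite (perm_mem rs) => /cd.
by rewrite !(perm_big _ rs).
Qed.

(** For two sums h, h' of the old family, let c and d be coefficients on r with
    sum c + h = sum d + h'.  As r has no relation within twice the bounds, the
    difference c - d is determined by h and h'.  Removing one index where it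
    does not vanish, for each pair (h, h'), thus destroys all the relations
    between r and s. *)
Lemma dissociated_prune (V : zmodType) (I : eqType) (i0 : I) (v : I -> V)
    (M : I -> nat) (r s : seq I) :
    uniq (r ++ s) -> (forall i, 0 < M i)%N ->
    dissociated v M s -> dissociated v (fun i => (2 * M i)%N) r ->
  exists X : seq I, (size X <= size (box v M s) ^ 2)%N /\
    dissociated v M ([seq i <- r | i \notin X] ++ s).
Proof.
rewrite cat_uniq => /and3P[ur /hasPn rs us] M0 fs fr.
pose bad (hh : V * V) (c d : I -> nat) :=
  {in r, forall i, (c i < M i)%N /\ (d i < M i)%N} /\
  \sum_(i <- r) v i *+ c i + hh.1 = \sum_(i <- r) v i *+ d i + hh.2.
have /choice[g gP] : forall hh : V * V, exists i : I, hh.1 <> hh.2 ->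
    (exists c d, bad hh c d) -> exists c d, [/\ bad hh c d, i \in r & c i <> d i].
  move=> hh; have [[c [d cd]]|nbad] := pselect (exists c d, bad hh c d); last by exists i0.
  have [[i [ir cdi]]|/forallNP eq_cd] := pselect (exists i, i \in r /\ c i <> d i).
    by exists i => _ _; exists c, d.
  exists i0 => nhh _; case: nhh; case: cd => _ E; apply: (addrI (\sum_(i <- r) v i *+ c i)).
  rewrite E; congr (_ + _); apply: eq_big_seq => i ir.
  by have /not_andP[/(_ ir)//|/contrapT ->] := eq_cd i.
pose X := [seq g (h, h') | h <- box v M s, h' <- box v M s].
exists X; split; first by rewrite size_allpairs mulnn.
set r' := [seq i <- r | i \notin X].
move=> c d cd; rewrite !big_cat /= => E.
pose z (e : I -> nat) i := if i \in r' then e i else 0%N.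
have zS e : \sum_(i <- r) v i *+ z e i = \sum_(i <- r') v i *+ e i.
  rewrite /r' big_filter [RHS]big_mkcond; apply: eq_big_seq => i ir.
  by rewrite /z mem_filter ir andbT; case: ifP.
have zb e : {in r' ++ s, forall i, e i < M i}%N -> {in r, forall i, z e i < M i}%N.
  by move=> eM i ir; rewrite /z; case: ifP => // ir'; apply: eM; rewrite mem_cat ir'.
have zc := zb c (fun i ii => (cd i ii).1).
have zd := zb d (fun i ii => (cd i ii).2).
set h := \sum_(i <- s) v i *+ c i in E; set h' := \sum_(i <- s) v i *+ d i in E.
have hs : h \in box v M s.
  by apply/mem_boxP => //; exists c => // i si; case: (cd i) => //; rewrite mem_cat si orbT.
have h's : h' \in box v M s.
  by apply/mem_boxP => //; exists d => // i si; case: (cd i) => //; rewrite mem_cat si orbT.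
have [hh'|/eqP hh'] := eqVneq h h'.
  have zcd : {in r, z c =1 z d}.
    apply: fr => [i ir|]; last by apply: (addIr h); rewrite !zS E hh'.
    by split; apply: leq_trans (leq_pmull _ (isT : 0 < 2)%N); [exact: zc|exact: zd].
  move=> i; rewrite mem_cat => /orP[ir'|]; last first.
    by apply: fs => // j js; apply: cd; rewrite mem_cat js orbT.
  have := zcd i; rewrite /z ir'; apply.
  by move: ir'; rewrite mem_filter => /andP[].
have [|c0 [d0 [[cd0 E0] gr gcd]]] := gP (h, h') hh'.
  by exists (z c), (z d); split => /=; [move=> i ir; split; [exact: zc|exact: zd]|rewrite !zS].
case: gcd; set i := g (h, h') in gr *.
have /(_ i gr) : {in r, (fun i => z c i + d0 i)%N =1 (fun i => z d i + c0 i)%N}.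
  apply: fr => [j jr|].
    by have := cd0 _ jr; have := zc _ jr; have := zd _ jr; lia.
  under eq_bigr => j _ do rewrite mulrnDr.
  under [RHS]eq_bigr => j _ do rewrite mulrnDr.
  rewrite !big_split /= !zS; move: E0 => /= E0.
  have -> : \sum_(j <- r') v j *+ c j = \sum_(j <- r') v j *+ d j + h' - h.
    by rewrite -E addrK.
  have -> : \sum_(j <- r) v j *+ c0 j = \sum_(j <- r) v j *+ d0 j + h' - h.
    by rewrite -E0 addrK.
  by rewrite -!addrA; congr (_ + _); rewrite addrCA [RHS]addrCA addrC addrA addrC.
have : i \notin r'.
  rewrite mem_filter negb_and negbK; apply/orP; left.
  by apply/allpairsP; exists (h, h').
by rewrite /= /z => /negbTE ->; rewrite !add0n.
Qed.

(** The sizes of the levels.  Write b for a bound on the number of coefficient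
    vectors on the levels below n ([volume]).  Pruning level n removes at most
    b^2 vectors, and [width] exceeds (n + 1) b^2 so that a bounded number of
    such removals cannot exhaust the late levels.  The bound [reach] on the coefficients at level n
    makes the weighted sum in [sum_weight_lvl] at most 2^-(n+1). *)
Definition width (n b : nat) : nat := (n.+1 * b ^ 2).+1.
Definition reach (n b : nat) : nat := (width n b * (n.+1 * 4) * 2 ^ n.+1)%N.
Fixpoint volume (n : nat) : nat :=
  if n is m.+1 then (volume m * reach m (volume m) ^ width m (volume m))%N else 2%N.

Definition lvl_size (n : nat) : nat := width n (volume n).
Definition lvl_bound (n : nat) : nat := reach n (volume n).

Arguments lvl_size : simpl never.
Arguments lvl_bound : simpl never.

Lemma lvl_bound_gt0 n : (0 < lvl_bound n)%N.
Proof. by rewrite /lvl_bound /reach !muln_gt0 expn_gt0. Qed.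

(** [None] labels the term to be separated from 1, [Some (n, k)] the vector
    number k of level n. *)
Definition label := option (nat * nat).
Definition label_bound (i : label) : nat :=
  if i is Some (n, _) then lvl_bound n else 2%N.
Definition lvl_labels (n : nat) : seq label :=
  [seq Some (n, k) | k <- iota 0 (lvl_size n)].

Lemma label_bound_gt0 i : (0 < label_bound i)%N.
Proof. by case: i => [[n k]|] //=; exact: lvl_bound_gt0. Qed.

Lemma uniq_lvl_labels n : uniq (lvl_labels n).
Proof. by rewrite map_inj_uniq ?iota_uniq // => k l []. Qed.

Lemma mem_lvl_labels n i :
  i \in lvl_labels n -> exists2 k, (k < lvl_size n)%N & i = Some (n, k).
Proof. by case/mapP => k; rewrite mem_iota add0n => /andP[_ kn] ->; exists k. Qed.

(** [s n] lists the labels of the levels below n that survive the pruning; the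
    inactive levels impose nothing. *)
Definition kept_at (active : nat -> Prop) (s : nat -> seq label) (n : nat) :=
  if `[< active n >] then exists X : seq label, (size X <= volume n ^ 2)%N /\
     s n.+1 = [seq i <- lvl_labels n | i \notin X] ++ s n
  else s n.+1 = s n.

Lemma exists_kept (V : zmodType) (v : label -> V) (active : nat -> Prop) :
    v None <> 0 ->
    (forall n, active n ->
      dissociated v (fun i => (2 * label_bound i)%N) (lvl_labels n)) ->
  exists s : nat -> seq label,
    [/\ s 0%N = [::], forall n, uniq (None :: s n),
        forall n, dissociated v label_bound (None :: s n) &
        forall n, kept_at active s n].
Proof.
move=> v0 act.
pose inv n (s : seq label) := [/\ uniq (None :: s),
  forall i, i \in s -> exists m k, (m < n)%N /\ i = Some (m, k),
  dissociated v label_bound (None :: s) &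
  (size (box v label_bound (None :: s)) <= volume n)%N].
pose rel n (s s' : seq label) := if `[< active n >] then
  exists X : seq label, (size X <= volume n ^ 2)%N /\
     s' = [seq i <- lvl_labels n | i \notin X] ++ s else s' = s.
have step n s : exists s', inv n s -> inv n.+1 s' /\ rel n s s'.
  rewrite /rel; case: asboolP => [an|nan]; last first.
    exists s => -[us sl ds bs]; split=> //; split=> //.
      by move=> i /sl [m [k [mn ->]]]; exists m, k; split => //; exact: ltnW.
    by apply: leq_trans bs _; rewrite /= leq_pmulr // expn_gt0 lvl_bound_gt0.
  have [iv|] := pselect (inv n s); last by exists s.
  have [us sl ds bs] := iv.
  have dis : uniq (lvl_labels n ++ (None :: s)).
    rewrite cat_uniq uniq_lvl_labels us andbT; apply/hasPn => i.
    rewrite inE => /orP[/eqP ->|/sl [m [k [mn ->]]]]; apply/negP => /mapP [l _] // [nm _].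
    by rewrite nm ltnn in mn.
  have [X [Xs dX]] := dissociated_prune None dis label_bound_gt0 ds (act n an).
  pose r := [seq i <- lvl_labels n | i \notin X].
  exists (r ++ s) => _; split; last first.
    by exists X; split => //; apply: leq_trans Xs _; rewrite leq_exp2r.
  have pm : perm_eq (r ++ None :: s) (None :: r ++ s).
    by rewrite -cat1s perm_catCA.
  have rl i : i \in r -> exists2 k, (k < lvl_size n)%N & i = Some (n, k).
    by rewrite mem_filter => /andP[_ /mem_lvl_labels].
  split.
  - rewrite -(perm_uniq pm); apply: subseq_uniq dis.
    by apply: cat_subseq => //; exact: filter_subseq.
  - move=> i; rewrite mem_cat => /orP[/rl [k _ ->]|/sl [m [k [mn ->]]]].
      by exists n, k.
    by exists m, k; split => //; exact: ltnW.
  - exact: dissociated_perm pm dX.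
  - move: bs; rewrite !size_box -(perm_big _ pm) big_cat => bs /=.
    rewrite mulnC -/(lvl_bound n) -/(lvl_size n); apply: leq_mul => //.
    rewrite big_seq (eq_bigr (fun=> lvl_bound n)); last by move=> i /rl [k _ ->].
    rewrite -big_seq big_const_seq count_predT iter_muln_1.
    rewrite leq_pexp2l ?lvl_bound_gt0 // size_filter.
    by apply: leq_trans (count_size _ _) _; rewrite size_map size_iota.
have /choice[f fP] : forall ns : nat * seq label, exists s',
    inv ns.1 ns.2 -> inv ns.1.+1 s' /\ rel ns.1 ns.2 s'.
  by move=> [n s]; exact: step.
pose s := fix s n := if n is m.+1 then f (m, s m) else [::].
have sI n : inv n (s n).
  elim: n => [|n IH]; last exact: (fP (n, s n) IH).1.
  split=> [//|//||//].
  move=> c d cd; rewrite !big_seq1 => E i; rewrite inE => /eqP ->.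
  have [] := cd None (mem_head _ _); rewrite [label_bound _]/= => cN dN.
  have [c0|c1] : c None = 0%N \/ c None = 1%N by lia.
    have [->//|d1] : d None = 0%N \/ d None = 1%N by lia.
    by case: v0; rewrite -[LHS]mulr1n -d1 -E c0.
  have [d0|->//] : d None = 0%N \/ d None = 1%N by lia.
  by case: v0; rewrite -[LHS]mulr1n -c1 E d0.
exists s; split => // n; try by have [] := sI n.
by have [_] := fP (n, s n) (sI n).
Qed.

(** The weights grow with the level: a character with
    weight |1 - chi|^2 <= 3 tends to 1 along the levels. *)
Definition weight (C : numClosedFieldType) (i : label) : C :=
  if i is Some (n, _) then n.+1%:R else 0.

Lemma weight_ge0 (C : numClosedFieldType) i : 0 <= weight C i.
Proof. by case: i => [[n k]|] /=. Qed.

Lemma sum_weight_lvl (C : numClosedFieldType) (n : nat) (r : seq label) :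
    (size r <= lvl_size n)%N -> {in r, forall i, exists k, i = Some (n, k)} ->
  \sum_(i <- r) weight C i * 4 / (label_bound i)%:R <= (2 ^ n.+1)%:R^-1.
Proof.
move=> rs rl.
rewrite big_seq (eq_bigr (fun=> n.+1%:R * 4 / (lvl_bound n)%:R)); last first.
  by move=> i /rl [k ->].
rewrite -big_seq big_const_seq count_predT iter_addr_0.
have bE : lvl_bound n = (lvl_size n * (n.+1 * 4) * 2 ^ n.+1)%N by [].
rewrite bE !natrM.
have -> : n.+1%:R * 4 / ((lvl_size n)%:R * (n.+1%:R * 4) * (2 ^ n.+1)%:R) =
    ((lvl_size n)%:R * (2 ^ n.+1)%:R)^-1 :> C.
  field; rewrite (nat1r n) !pnatr_eq0 expn_eq0 /=.
  by [].
rewrite -[X in X <= _]mulr_natl invfM mulrA ler_piMl ?invr_ge0 ?ler0n //.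
by rewrite ler_pdivrMr ?ltr0n // mul1r ler_nat.
Qed.

Lemma sum_weight_kept (C : numClosedFieldType) (active : nat -> Prop)
    (s : nat -> seq label) n : s 0%N = [::] -> (forall n, kept_at active s n) ->
  \sum_(i <- s n) weight C i * 4 / (label_bound i)%:R <= 1.
Proof.
move=> s0 kept; apply: (@le_trans _ _ (1 - (2 ^ n)%:R^-1)); last first.
  by rewrite gerBl invr_ge0.
elim: n => [|n IH]; first by rewrite s0 big_nil invr1 subrr.
have half : (2 ^ n)%:R^-1 = (2 ^ n.+1)%:R^-1 + (2 ^ n.+1)%:R^-1 :> C.
  rewrite expnS natrM; field; rewrite !pnatr_eq0 -lt0n expn_gt0 //.
have -> : 1 - (2 ^ n.+1)%:R^-1 = (2 ^ n.+1)%:R^-1 + (1 - (2 ^ n)%:R^-1) :> C.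
  by rewrite half; ring.
move: (kept n); rewrite /kept_at; case: ifP => _.
  case=> X [_ ->]; rewrite big_cat; apply: lerD; last exact: IH.
  apply: sum_weight_lvl => [|i].
    rewrite size_filter; apply: leq_trans (count_size _ _) _.
    by rewrite size_map size_iota.
  by rewrite mem_filter => /andP[_ /mem_lvl_labels[k _ ->]]; exists k.
by move=> ->; apply: le_trans IH _; rewrite lerDr invr_ge0.
Qed.

Lemma exists_kept_chars (C : numClosedFieldType) (X : choiceType)
    (v : label -> X -> int) (supp : label -> seq X) (active : nat -> Prop) :
    (forall i x, x \notin supp i -> v i x = 0) ->
    v None <> 0 ->
    (forall n, active n ->
      dissociated v (fun i => (2 * label_bound i)%N) (lvl_labels n)) ->
  exists s : nat -> seq label, (forall n, kept_at active s n) /\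
    forall n, exists (F : seq X) (a : X -> C), [/\ uniq F,
      {in None :: s n, forall i, {subset supp i <= F}},
      forall x, `|a x| = 1,
      1 <= `|1 - char_of F a (v None)| ^+ 2 &
      {in s n, forall i, weight C i * `|1 - char_of F a (v i)| ^+ 2 <= 3}].
Proof.
move=> suppP v0 act.
have [s [s0 us ds kept]] := exists_kept v0 act.
exists s; split => // n.
pose F := undup (flatten [seq supp i | i <- None :: s n]).
have subF : {in None :: s n, forall i, {subset supp i <= F}}.
  by move=> i iS x xi; rewrite mem_undup; apply/flatten_mapP; exists i.
have sF i : i \in None :: s n -> forall x, x \notin F -> v i x = 0.
  by move=> iS x xF; apply: suppP; apply: contra xF => /(subF _ iS).
have [a [a1 a2 a3]] := almost_trivial_char (undup_uniq _) sF (us n) (ds n)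
  label_bound_gt0 erefl (@weight_ge0 C) (sum_weight_kept C n s0 kept).
by exists F, a; split; rewrite ?undup_uniq.
Qed.

(** * Formal limits and the ultrafilters attached to them *)

(** [tlim f] is a formal limit of the double sequence f, whose level n consists
    of the f n k with k < lvl_size n. *)
Inductive term := tint of int | tadd of term & term | tlim of (nat -> nat -> term).

HB.instance Definition _ := gen_eqMixin term.
HB.instance Definition _ := gen_choiceMixin term.

Definition block := nat -> nat -> term.
HB.instance Definition _ := Choice.on block.
Definition coord := option block.

(** The class of a term in the free abelian group on the integer 1 (coordinate
    [None]) and the formal limits. *)
Fixpoint vec (t : term) : coord -> int :=
  match t with
  | tint n => fun x => if x is None then n else 0
  | tadd s u => vec s + vec u
  | tlim f => fun x => (x == Some (f : block))%:R
  end.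

Fixpoint top_blocks (t : term) : seq block :=
  match t with
  | tint _ => [::] | tadd s u => top_blocks s ++ top_blocks u | tlim f => [:: f : block]
  end.

Fixpoint eval (C : numClosedFieldType) (a : coord -> C) (t : term) : C :=
  match t with
  | tint n => a None ^ n
  | tadd s u => eval a s * eval a u
  | tlim f => a (Some (f : block))
  end.

(** The limits met at any depth inside a term, in contrast with
    [top_blocks]. *)
Fixpoint subblocks (t : term) : set block :=
  match t with
  | tint _ => set0
  | tadd s u => subblocks s `|` subblocks u
  | tlim f => [set f : block] `|` \bigcup_n \bigcup_k subblocks (f n k)
  end.

Lemma vec_supp (t : term) x : x \notin None :: map Some (top_blocks t) -> vec t x = 0.
Proof.
elim: t x => [n|s IHs u IHu|f _] [g|] //=; rewrite !inE //=.
  rewrite map_cat mem_cat negb_or => /andP[gs gu].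
  by rewrite -[LHS]/(vec s (Some g) + vec u (Some g)) IHs ?IHu.
by move=> /negbTE ->.
Qed.

Lemma vec_Some (t : term) g : vec t (Some g) = (count_mem g (top_blocks t))%:R.
Proof.
elim: t => [n|s IHs u IHu|f _] //=.
  by rewrite -[LHS]/(vec s (Some g) + vec u (Some g)) IHs IHu count_cat natrD.
by rewrite addn0 -[Some g == _]/(g == f) eq_sym.
Qed.

Lemma vec_neq0 (t : term) : top_blocks t <> [::] -> vec t <> 0.
Proof.
case E : (top_blocks t) => [//|g r] _ v0.
have := vec_Some t g; rewrite v0 E /= eqxx => /esym/eqP.
by rewrite -[_ == _]/((_ : int) == 0) pnatr_eq0.
Qed.

(** The finite set F contains the coordinate [None] and all limits of t even
    where they cancel in [vec t]. *)
Lemma eval_char (C : numClosedFieldType) (a : coord -> C) (F : seq coord)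
    (t : term) : (forall x, `|a x| = 1) -> uniq F ->
    {subset None :: map Some (top_blocks t) <= F} -> char_of F a (vec t) = eval a t.
Proof.
move=> a1 uF; elim: t => [n|s IHs u IHu|f _] sF /=.
- rewrite /char_of (bigD1_seq None) //=; last by rewrite sF.
  by rewrite big1 ?mulr1 // => -[g|].
- rewrite char_ofD // IHs ?IHu // => x; rewrite inE => /orP[/eqP ->|xm];
    apply: sF; rewrite ?inE //= map_cat mem_cat xm ?orbT //.
- rewrite /char_of (bigD1_seq (Some (f : block))) //.
    by rewrite eqxx expr1z big1 => [|x /negbTE ->]; rewrite ?expr0z //= mulr1.
  by apply: sF; rewrite in_cons mem_head orbT.
Qed.

Lemma eq_vec_eval (C : numClosedFieldType) (a : coord -> C) (s t : term) :
  (forall x, `|a x| = 1) -> vec s = vec t -> eval a s = eval a t.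
Proof.
move=> a1 st; pose F := undup (None :: map Some (top_blocks s ++ top_blocks t)).
have uF : uniq F by exact: undup_uniq.
rewrite -(eval_char a1 uF) -?(eval_char (t := t) a1 uF) ?st // => x;
  rewrite mem_undup !inE map_cat mem_cat => /orP[->//|->]; by rewrite ?orbT.
Qed.

Lemma top_blocks_subblocks (t : term) g : g \in top_blocks t -> subblocks t g.
Proof.
elim: t => [n|s IHs u IHu|f _] //=; first by rewrite mem_cat => /orP[/IHs|/IHu]; [left|right].
by rewrite inE => /eqP ->; left.
Qed.

Lemma subblocks_trans (t : term) g n k : subblocks t g -> subblocks (g n k) `<=` subblocks t.
Proof.
elim: t => [m|s IHs u IHu|f IH] //=.
  by move=> [/IHs|/IHu] h x /h hx; [left|right].
move=> [-> x hx|[m _ [l _ h]] x hx]; first by right; exists n => //; exists k.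
by right; exists m => //; exists l => //; exact: IH h _ hx.
Qed.

Lemma subblocks_irrefl (g : block) n k : ~ subblocks (g n k) g.
Proof.
suff H t : subblocks t g -> forall n k, ~ subblocks (g n k) g by move=> h; exact: (H _ h n k h).
elim: t {n k} => [m|s IHs u IHu|f IH] //=; first by move=> [/IHs|/IHu].
move=> [gf|[m _ [l _ /IH]]] // n k h; apply: (IH n k _ n k h).
by rewrite gf in h *.
Qed.

Lemma vec_block_self (g : block) n k : vec (g n k) (Some g) = 0.
Proof.
suff /count_memPn gE : g \notin top_blocks (g n k) by rewrite vec_Some gE.
by apply/negP => /top_blocks_subblocks; exact: subblocks_irrefl.
Qed.

Lemma countable_subblocks (t : term) : countable (subblocks t).
Proof.
elim: t => [n|s IHs u IHu|f IH] /=.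
- exact: countable0.
- rewrite (_ : _ `|` _ = \bigcup_(b in [set: bool]) if b then subblocks s else subblocks u).
    by apply: bigcup_countable => [|[]].
  rewrite eqEsubset; split=> x; first by move=> [h|h]; [exists true|exists false].
  by move=> [[] _ h]; [left|right].
- rewrite (_ : _ `|` _ = \bigcup_(b in [set: bool]) if b then [set f : block]
      else \bigcup_n \bigcup_k subblocks (f n k)).
    apply: bigcup_countable => [|[] _]; [exact: countableP|exact/finite_set_countable/finite_set1|].
    apply: bigcup_countable => [|n _]; first exact: countableP.
    by apply: bigcup_countable => [|k _]; [exact: countableP|exact: IH].
  rewrite eqEsubset; split=> x; first by move=> [h|h]; [exists true|exists false].
  by move=> [[] _ h]; [left|right].
Qed.

(** An injective coding of terms by sequences of natural numbers: there are
    only continuum many terms. *)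
Fixpoint code (t : term) (j : nat) : nat :=
  match t, j with
  | tint _, 0%N => 0%N
  | tadd _ _, 0%N => 1%N
  | tlim _, 0%N => 2%N
  | tint n, i.+1 => pickle n
  | tadd s u, i.+1 => if odd i then code s i./2 else code u i./2
  | tlim f, i.+1 =>
      if (unpickle i : option (nat * nat * nat)) is Some (n, k, l)
      then code (f n k) l else 0%N
  end.

Lemma code_inj : injective code.
Proof.
elim=> [n|s IHs u IHu|f IH] [m|s' u'|g] E; try by have := congr1 (@^~ 0%N) E.
- by have /(pcan_inj pickleK) -> := congr1 (@^~ 1%N) E.
- congr tadd; [apply: IHs|apply: IHu]; apply/funext => i.
    by have := congr1 (@^~ i.*2.+2) E; rewrite /= odd_double /= uphalf_double.
  by have := congr1 (@^~ i.*2.+1) E; rewrite /= odd_double /= doubleK.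
- congr tlim; apply/funext => n; apply/funext => k; apply: IH; apply/funext => l.
  by have := congr1 (@^~ (pickle (n, k, l)).+1) E; rewrite /= pickleK.
Qed.

(** The branch of the tree of finite sequences that follows the code of f:
    distinct branches share only finitely many nodes. *)
Definition levels (f : block) : set nat :=
  [set n | exists j, n = pickle (mkseq (code (tlim f)) j)].

Lemma levels_almost_disjoint (f g : block) : f <> g ->
  exists n0, forall n, (n0 <= n)%N -> levels f n -> ~ levels g n.
Proof.
move=> fg.
have [j0 cj0] : exists j, code (tlim f) j <> code (tlim g) j.
  apply: contrapT => /forallNP H; apply: fg.
  suff : tlim f = tlim g by case.
  by apply: code_inj; apply/funext => j; apply: contrapT; exact: H.
exists (\max_(j < j0.+1) pickle (mkseq (code (tlim f)) j)).+1 => n n0 [j nj] [l].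
rewrite nj => /(pcan_inj pickleK) E.
have jl : j = l by have := congr1 size E; rewrite !size_mkseq.
have [jj0|j0j] := leqP j j0.
  move: n0; rewrite nj ltnNge => /negP; apply.
  exact: (leq_bigmax (Ordinal (jj0 : j < j0.+1)%N)).
have := congr1 (nth 0%N ^~ j0) E; rewrite !nth_mkseq // -jl //.
Qed.

Lemma levels_unbounded (f : block) n0 : exists2 n, (n0 <= n)%N & levels f n.
Proof.
apply: contrapT => H.
have lt j : (pickle (mkseq (code (tlim f)) j) < n0)%N.
  rewrite ltnNge; apply/negP => n0j; apply: H.
  by exists (pickle (mkseq (code (tlim f)) j)) => //; exists j.
pose h (j : 'I_n0.+1) : 'I_n0 := Ordinal (lt j).
have : injective h.
  move=> i j [/(pcan_inj pickleK)/(congr1 size)]; rewrite !size_mkseq => ij.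
  exact: val_inj.
by move=> /leq_card; rewrite !card_ord ltnn.
Qed.

(** A level in several sets [levels f] goes to the f that comes first in an
    enumeration of D; by almost disjointness each f loses only finitely many
    levels to its predecessors. *)
Lemma exists_owner (D : set block) : countable D ->
  exists own : nat -> option block,
    (forall n f, own n = Some f -> D f /\ levels f n) /\
    (forall f, D f -> exists n0, forall n, (n0 <= n)%N -> levels f n ->
       own n = Some f).
Proof.
move=> /countable_injP[g gD].
have ginj f f' : D f -> D f' -> g f = g f' -> f = f' by move=> Df Df'; apply: gD; apply: mem_set.
pose cand n m := `[< exists f, [/\ D f, levels f n & g f = m] >].
have /choice[own ownP] : forall n, exists o : option block,
    if o is Some f then [/\ D f, levels f n & forall f', D f' -> levels f' n -> (g f <= g f')%N]
    else forall f, D f -> ~ levels f n.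
  move=> n; have [ex|nex] := pselect (exists m, cand n m); last first.
    by exists None => f Df fn; apply: nex; exists (g f); apply/asboolP; exists f.
  have [m /asboolP[f [Df fn fm]] mmin] := ex_minnP ex.
  exists (Some f); split => // f' Df' f'n; rewrite fm; apply: mmin.
  by apply/asboolP; exists f'.
exists own; split; first by move=> n f fE; have := ownP n; rewrite fE => -[].
move=> f Df.
have /choice[n0 n0P] : forall m, exists n0, forall f', D f' -> g f' = m -> f' <> f ->
    forall n, (n0 <= n)%N -> levels f' n -> ~ levels f n.
  move=> m; have [[f' [Df' f'm f'f]]|nex] := pselect (exists f', [/\ D f', g f' = m & f' <> f]).
    have [n0 n0P] := levels_almost_disjoint f'f.
    by exists n0 => f'' Df'' f''m _; rewrite (ginj f'' f') // f''m.
  by exists 0%N => f' Df' f'm f'f; case: nex; exists f'.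
exists (\max_(m < (g f).+1) n0 m) => n n0n fn.
have := ownP n; case: (own n) => [f' [Df' f'n f'min]|/(_ f Df)//].
congr Some; apply: contrapT => f'f.
have gf' : (g f' < (g f).+1)%N by rewrite ltnS f'min.
apply: (n0P (g f') f' Df' erefl f'f n _ f'n fn).
exact: leq_trans (leq_bigmax (Ordinal gf')) n0n.
Qed.

(** Pruning level n removes at most volume n ^ 2 vectors; the factor j makes
    finite intersections of large sets large. *)
Definition large (f : block) (U : set (nat * nat)) :=
  exists j n0, forall n, (n0 <= n)%N -> levels f n ->
    (count (fun k => `[< ~ U (n, k) >]) (iota 0 (lvl_size n)) <= j * volume n ^ 2)%N.

(** Properness: the level n contains more than n + 1 times the vectors removed
    by one pruning. *)
Lemma large_filter (f : block) : ProperFilter (large f).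
Proof.
split.
  move=> [j [n0 H]].
  have [n n0n fn] := levels_unbounded f (maxn n0 j).
  have := H n (leq_trans (leq_maxl _ _) n0n) fn.
  rewrite (eq_count (a2 := predT)); last by move=> k; apply/asboolP.
  rewrite count_predT size_iota leqNgt => /negP; apply.
  rewrite /lvl_size /width ltnS leq_mul2r; apply/orP; right.
  by apply: leqW; apply: leq_trans n0n; exact: leq_maxr.
split.
- exists 0%N, 0%N => n _ _; rewrite (eq_count (a2 := pred0)) ?count_pred0 //.
  by move=> k; apply/asboolP => /(_ I).
- move=> U W [j [n0 HU]] [j' [n0' HW]].
  exists (j + j')%N, (maxn n0 n0') => n; rewrite geq_max => /andP[nn nn'] fn.
  rewrite mulnDl; apply: leq_trans (leq_add (HU n nn fn) (HW n nn' fn)).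
  rewrite -count_predUI; apply: leq_trans (leq_addr _ _); apply: sub_count => k.
  by move=> /asboolP /not_andP[H|H]; apply/orP; [left|right]; apply/asboolP.
- move=> U W UW [j [n0 HU]]; exists j, n0 => n nn fn.
  apply: leq_trans (HU n nn fn); apply: sub_count => k /asboolP H.
  by apply/asboolP => /UW.
Qed.

Lemma large_level (f : block) n0 : large f [set nk | n0 <= nk.1]%N.
Proof.
exists 0%N, n0 => n n0n _; rewrite (eq_count (a2 := pred0)) ?count_pred0 //.
by move=> k; apply/asboolP => /(_ n0n).
Qed.

Lemma exists_ultra (f : block) :
  exists G : set_system (nat * nat), UltraFilter G /\ large f `<=` G.
Proof. exact: ultraFilterLemma (large_filter f). Qed.

Definition block_ultra (f : block) : set_system (nat * nat) := projT1 (cid (exists_ultra f)).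

Lemma block_ultra_ultra (f : block) : UltraFilter (block_ultra f).
Proof. by rewrite /block_ultra; case: cid => ? []. Qed.

Lemma block_ultra_proper (f : block) : ProperFilter (block_ultra f).
Proof. exact: (@ultra_proper _ _ (block_ultra_ultra f)). Qed.

Lemma large_block_ultra (f : block) : large f `<=` block_ultra f.
Proof. by rewrite /block_ultra; case: cid => ? []. Qed.

(** * Admissible characters *)

(** Twice the bound, as needed in [dissociated_prune]. *)
Definition dissociated_block (f : block) := forall n,
  dissociated (fun k => vec (f n k)) (fun=> (2 * lvl_bound n)%N)
    (iota 0 (lvl_size n)).

Definition admissible (C : numClosedFieldType) (a : coord -> C) :=
  (forall x, `|a x| = 1) /\
  forall f, dissociated_block f ->
    (fun nk : nat * nat => eval a (f nk.1 nk.2)) @ block_ultra f --> a (Some f).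

Lemma cvg_norm1 (C : numClosedFieldType) (T : Type) (G : set_system T)
    (u : T -> C) (l : C) : ProperFilter G -> (forall i, `|u i| = 1) ->
  u @ G --> l -> `|l| = 1.
Proof.
move=> GP u1 /cvg_norm ul; apply: (cvg_unique (@norm_hausdorff _ C)) ul _.
by apply: cvg_near_cst; apply: nearW => i /=; rewrite u1.
Qed.

Lemma cvg_exprz (C : numClosedFieldType) (T : Type) (G : set_system T)
    (u : T -> C) (l : C) (n : int) : Filter G -> l != 0 ->
  u @ G --> l -> (fun i => u i ^ n) @ G --> l ^ n.
Proof.
move=> GF l0 ul.
have pos m : (fun i => u i ^+ m) @ G --> l ^+ m.
  elim: m => [|m IH]; first exact: cvg_cst.
  rewrite exprS (_ : (fun _ => _) = (fun i => u i * u i ^+ m)).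
    exact: cvgM.
  by apply/funext => i; rewrite exprS.
case: n => m; first exact: pos.
have := @cvgV _ _ _ GF _ _ (expf_neq0 m.+1 l0) (pos m.+1).
by rewrite NegzE -exprnN.
Qed.

Lemma cvg_eval (C : numClosedFieldType) (T : Type) (G : set_system T)
    (a : T -> coord -> C) (l : coord -> C) (t : term) : Filter G ->
  (forall x, l x != 0) -> (forall x, a^~ x @ G --> l x) ->
  (fun i => eval (a i) t) @ G --> eval l t.
Proof.
move=> GF l0 al; elim: t => [n|s IHs u IHu|f _] /=; last exact: al.
  exact: cvg_exprz.
exact: (cvgM IHs IHu).
Qed.

(** A choice of limits, so that characters may be extended by recursion on
    terms. *)
Lemma exists_lim_op (C : numClosedFieldType) :
    compact [set z : C | `|z| <= 1] ->
  exists L : block -> (nat -> nat -> C) -> C,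
    forall f u, (forall n k, `|u n k| = 1) ->
    `|L f u| = 1 /\ (fun nk : nat * nat => u nk.1 nk.2) @ block_ultra f --> L f u.
Proof.
move=> cpt.
have /choice[L LP] : forall fu : block * (nat -> nat -> C), exists l : C,
    (forall n k, `|fu.2 n k| = 1) ->
    `|l| = 1 /\ (fun nk : nat * nat => fu.2 nk.1 nk.2) @ block_ultra fu.1 --> l.
  move=> [f u] /=; have [u1|nu] := pselect (forall n k, `|u n k| = 1); last by exists 0.
  have BP := block_ultra_proper f.
  have [|l ul] := @ultra_cvg_compact _ _ _ _ (fun nk : nat * nat => u nk.1 nk.2)
    cpt (block_ultra_ultra f); first by apply: (@filterE _ (block_ultra f)) => nk; rewrite /= u1.
  by exists l => _; split => //; apply: cvg_norm1 ul => nk; exact: u1.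
by exists (fun f u => L (f, u)) => f u u1; exact: (LP (f, u)).
Qed.

Fixpoint extend_assign (C : numClosedFieldType) (L : block -> (nat -> nat -> C) -> C)
    (D : set block) (b : coord -> C) (t : term) : C :=
  match t with
  | tint n => b None ^ n
  | tadd s u => extend_assign L D b s * extend_assign L D b u
  | tlim f => if `[< D f >] then b (Some (f : block))
              else L f (fun n k => extend_assign L D b (f n k))
  end.

Lemma exists_admissible_extension (C : numClosedFieldType) (D : set block)
    (b : coord -> C) : compact [set z : C | `|z| <= 1] ->
    (forall x, `|b x| = 1) ->
    (forall f, D f -> forall n k, subblocks (f n k) `<=` D) ->
    (forall f, D f -> dissociated_block f ->
      (fun nk : nat * nat => eval b (f nk.1 nk.2)) @ block_ultra f --> b (Some f)) ->
  exists a : coord -> C, admissible a /\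
    forall t, subblocks t `<=` D -> eval a t = eval b t.
Proof.
move=> cpt b1 Dh bD; have [L LP] := exists_lim_op cpt.
pose a (x : coord) : C := if x is Some f then extend_assign L D b (tlim f) else b None.
have aE t : eval a t = extend_assign L D b t by elim: t => [n|s IHs u IHu|f _] //=; rewrite IHs IHu.
have e1 t : `|extend_assign L D b t| = 1.
  elim: t => [n|s IHs u IHu|f IH] /=.
  - by case: n => n; rewrite ?NegzE -?exprnN ?normfV normrX b1 expr1n ?invr1.
  - by rewrite normrM IHs IHu mulr1.
  - by case: ifP => _ //; have [] := LP f (fun n k => extend_assign L D b (f n k)) IH.
have ab t : subblocks t `<=` D -> eval a t = eval b t.
  elim: t => [n|s IHs u IHu|f IH] //= h.
    by congr (_ * _); [apply: IHs|apply: IHu] => x hx; apply: h; [left|right].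
  by rewrite asboolT //; apply: h; left.
exists a; split => //; split.
  by case => [f|]; [exact: (e1 (tlim f))|exact: b1].
move=> f fg; rewrite /a /=; case: asboolP => Df.
  rewrite (_ : (fun _ => _) = (fun nk : nat * nat => eval b (f nk.1 nk.2))); first exact: bD.
  by apply/funext => nk; rewrite ab //; exact: Dh.
rewrite (_ : (fun _ => _) = (fun nk : nat * nat => extend_assign L D b (f nk.1 nk.2))).
  by have [] := LP f (fun n k => extend_assign L D b (f n k)) (fun n k => e1 _).
by apply/funext => nk; rewrite aE.
Qed.

Lemma sum_fctE (X I : Type) (r : seq I) (g : I -> X -> int) (c : I -> nat) x :
  (\sum_(i <- r) g i *+ c i) x = \sum_(i <- r) g i x *+ c i.
Proof.
elim: r => [|i r IH]; first by rewrite !big_nil.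
rewrite !big_cons -IH -[LHS]/((g i *+ c i) x + _); congr (_ + _).
by elim: (c i) => [|m IHm]; rewrite ?mulr0n // !mulrS -IHm.
Qed.

(** The coordinate of [tlim f], which does not occur in the f n k, forces the
    two sums of coefficients to agree, and then [tlim f] cancels. *)
Lemma dissociated_sub_lim (f : block) n : dissociated_block f ->
  dissociated (fun k => vec (f n k) - vec (tlim f)) (fun=> (2 * lvl_bound n)%N)
    (iota 0 (lvl_size n)).
Proof.
move=> fg c d cd E; apply: fg => //.
set r := iota _ _ in E *.
have Ec e : \sum_(k <- r) vec (f n k) *+ e k =
    \sum_(k <- r) (vec (f n k) - vec (tlim f)) *+ e k + vec (tlim f) *+ (\sum_(k <- r) e k).
  by rewrite -sumrMnr -big_split; apply: eq_bigr => k _; rewrite /= -mulrnDl subrK.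
rewrite !Ec E; congr (_ + _ *+ _).
have S e : (\sum_(k <- r) (vec (f n k) - vec (tlim f)) *+ e k) (Some f) =
    (-1) *+ (\sum_(k <- r) e k).
  rewrite sum_fctE -sumrMnr; apply: eq_bigr => k _; congr (_ *+ _).
  by rewrite -[LHS]/(vec (f n k) (Some f) - (Some f == Some f)%:R) vec_block_self eqxx sub0r.
have /eqP := congr1 (@^~ (Some f)) E.
by rewrite !S !mulNrn eqr_opp eqr_nat => /eqP.
Qed.

(** * Terms with a formal limit are separated from the integers *)

(** Otherwise the multiples of e would form an infinite e-separated sequence in
    the disc. *)
Lemma compact_disc_archimedean (C : numClosedFieldType) (e : C) :
    compact [set z : C | `|z| <= 1] -> 0 < e ->
  exists n0, forall n, (n0 <= n)%N -> n.+1%:R^-1 < e.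
Proof.
move=> cpt e0.
suff [n0 ne] : exists n0, n0.+1%:R^-1 < e.
  exists n0 => n nn; apply: le_lt_trans ne.
  by rewrite lef_pV2 ?posrE ?ltr0n // ler_nat.
apply: contrapT => /forallNP small.
have le1 n : n%:R * e <= 1.
  case: n => [|n]; first by rewrite mul0r.
  rewrite mulrC -ler_pdivlMr ?ltr0n // mul1r real_leNgt ?gtr0_real ?invr_gt0 ?ltr0n //.
  exact/negP/small.
have [|l [_ cl]] := cpt ((fun n : nat => n%:R * e) @ \oo) _.
  apply: (@filterE _ \oo _ ((fun n : nat => n%:R * e) @^-1` [set z : C | `|z| <= 1])).
  by move=> n /=; rewrite ger0_norm // mulr_ge0 // ltW.
pose W : set C := [set z | `|l - z| < e / 2].
have Wl : nbhs l W by apply: (@nbhsx_ballx _ C) ; rewrite divr_gt0.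
have inf N : exists2 n, (N <= n)%N & W (n%:R * e).
  have [|z [[n /= Nn <-] Wz]] := cl [set n%:R * e | n in [set n | N <= n]%N] W _ Wl.
    by exists N => // n /= Nn; exists n.
  by exists n.
have [n _ Wn] := inf 0%N; have [m nm Wm] := inf n.+1.
have : `|m%:R * e - n%:R * e| < e.
  have -> : m%:R * e - n%:R * e = (m%:R * e - l) + (l - n%:R * e) by rewrite addrA subrK.
  apply: le_lt_trans (ler_normD _ _) _; rewrite [in X in X + _]distrC.
  by rewrite [ltRHS](splitr e) ltrD.
rewrite -mulrBl -natrB ?(ltnW nm) // normrM normr_nat (gtr0_norm e0) gtr_pMl //.
by rewrite ltrn1 => /eqP; lia.
Qed.

(** Level n is active when it belongs to a dissociated limit f of t, with
    vectors f n k - tlim f.  The characters of [exists_kept_chars] satisfy the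
    requirements below a given level; their limit b along an ultrafilter
    satisfies all of them, and the labels kept at the levels of f form a large
    set, so b is continuous at each limit of t.  The values outside the limits
    of t are then supplied by [exists_admissible_extension]. *)
Lemma separation (C : numClosedFieldType) (t : term) :
    compact [set z : C | `|z| <= 1] -> top_blocks t <> [::] ->
  exists a : coord -> C, admissible a /\ eval a t <> 1.
Proof.
move=> cpt gt0.
have [own [own1 own2]] := exists_owner (countable_subblocks t).
pose v (i : label) : coord -> int :=
  match i with
  | None => vec t
  | Some (n, k) => if own n is Some f then vec (f n k) - vec (tlim f) else 0
  end.
pose supp (i : label) : seq coord :=
  match i with
  | None => None :: map Some (top_blocks t)
  | Some (n, k) => if own n is Some f then
      [:: None, Some f & map Some (top_blocks (f n k))] else [::]
  end.
pose active n := exists2 f, own n = Some f & dissociated_block f.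
have suppv i x : x \notin supp i -> v i x = 0.
  case: i => [[n k]|] /=; last exact: vec_supp.
  case: (own n) => [f|] //; rewrite !inE !negb_or => /and3P[xN xf xg].
  rewrite -[LHS]/(vec (f n k) x - (x == Some f)%:R) (negbTE xf) subr0.
  by apply: vec_supp; rewrite inE negb_or xN.
have disv n : active n ->
    dissociated v (fun i => (2 * label_bound i)%N) (lvl_labels n).
  move=> [f fn fg] c d cd; rewrite !big_map => E i /mem_lvl_labels[k kn ->].
  have vE e : \sum_(j <- iota 0 (lvl_size n)) v (Some (n, j)) *+ e (Some (n, j)) =
      \sum_(j <- iota 0 (lvl_size n)) (vec (f n j) - vec (tlim f)) *+ e (Some (n, j)).
    by apply: eq_bigr => j _; rewrite /v fn.
  have /(_ k) : {in iota 0 (lvl_size n),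
      (fun k => c (Some (n, k))) =1 (fun k => d (Some (n, k)))}.
    apply: (dissociated_sub_lim (n := n) fg) => [j jn|]; last by rewrite -!vE.
    by apply: (cd (Some (n, j))); exact: map_f.
  by apply; rewrite mem_iota add0n.
have [s [kept /choice[F /choice[a aP]]]] :=
  @exists_kept_chars C _ v supp active suppv (vec_neq0 gt0) disv.
have [G [GU Goo]] := ultraFilterLemma (eventually_filter : ProperFilter \oo).
have GP := @ultra_proper _ _ GU.
have a1 n x : `|a n x| = 1 by have [] := aP n.
have /choice[b bP] : forall x, exists l : C, a^~ x @ G --> l.
  by move=> x; apply: (ultra_cvg_compact cpt GU); apply: (@filterE _ G) => n; rewrite /= a1.
have b1 x : `|b x| = 1 by apply: cvg_norm1 (bP x) => n.
have b0 x : b x != 0 by rewrite -normr_eq0 b1 oner_eq0.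
have evb u : (fun n => eval (a n) u) @ G --> eval b u by exact: cvg_eval.
have eb : eval b t <> 1.
  move=> e1; have /cvgrPdist_lt/(_ 1 ltr01) := evb t; rewrite e1 => H.
  have [n /= nlt] := @filter_ex _ _ GP _ H.
  have [uF sF _ + _] := aP n; rewrite eval_char //; last first.
    by apply: (sF None); rewrite mem_head.
  move=> le1; have : `|1 - eval (a n) t| ^+ 2 < 1 by rewrite expr_lt1.
  by move=> /(le_lt_trans le1); rewrite ltxx.
have mono n m i : (n <= m)%N -> i \in s n -> i \in s m.
  elim: m => [|m IH]; first by rewrite leqn0 => /eqP ->.
  rewrite leq_eqVlt => /orP[/eqP -> //|/IH {}IH /IH im].
  have := kept m; rewrite /kept_at; case: ifP => _; last by move=> ->.
  by move=> [X [_ ->]]; rewrite mem_cat im orbT.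
have bound n k f : own n = Some f -> Some (n, k) \in s n.+1 ->
    n.+1%:R * `|b (Some f) - eval b (f n k)| ^+ 2 <= 3.
  move=> fn nks.
  (* A polynomial in the values of g, so that the bound passes to the limit. *)
  pose w (g : coord -> C) := n.+1%:R *
    ((g (Some f) - eval g (f n k)) * (g (Some f) - eval g (f n k))).
  have nw g : `|w g| = n.+1%:R * `|g (Some f) - eval g (f n k)| ^+ 2.
    by rewrite /w !normrM normr_nat expr2.
  rewrite -nw; apply: (@cvg_norm_le C _ G (fun j => w (a j))) => //.
    have h : (fun j => a j (Some f) - eval (a j) (f n k)) @ G --> b (Some f) - eval b (f n k).
      by apply: cvgB; [exact: bP|exact: evb].
    by apply: cvgM; [exact: cvg_cst|exact: cvgM].
  apply: Goo; exists n.+1 => // j /= nj; rewrite nw.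
  have [uF sF _ _ cF] := aP j.
  have := cF _ (mono _ _ _ nj nks); rewrite /= fn.
  have sub := sF (Some (n, k)); rewrite inE (mono _ _ _ nj nks) orbT /= fn in sub.
  have {}sub := sub isT.
  have cfl : char_of (F j) (a j) (vec (tlim f)) = a j (Some f).
    rewrite eval_char // => x; rewrite !inE => /orP[/eqP ->|/eqP ->]; apply: sub;
      by rewrite !inE ?eqxx ?orbT.
  have cff : char_of (F j) (a j) (vec (f n k)) = eval (a j) (f n k).
    apply: eval_char => // x; rewrite !inE => /orP[/eqP ->|xg]; apply: sub;
      by rewrite !inE ?eqxx ?xg ?orbT.
  have : char_of (F j) (a j) (vec (f n k) - vec (tlim f)) * a j (Some f) = eval (a j) (f n k).
    by rewrite -cfl -char_ofD // subrK.
  set z := char_of _ _ _ => <-.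
  have -> : a j (Some f) - z * a j (Some f) = (1 - z) * a j (Some f).
    by rewrite mulrBl mul1r.
  by rewrite normrM a1 mulr1.
have [g [ga gE]] : exists g : coord -> C, admissible g /\
    forall u, subblocks u `<=` subblocks t -> eval g u = eval b u.
  apply: exists_admissible_extension => //.
    by move=> f Df n k; exact: subblocks_trans.
  move=> f Df fg; have BP := block_ultra_proper f.
  apply/cvgrPdist_lt => e e0.
  have [n0 n0P] : exists n0, forall n, (n0 <= n)%N -> n.+1%:R^-1 < e ^+ 2 / 3.
    by apply: compact_disc_archimedean => //; rewrite divr_gt0 ?exprn_gt0.
  (* U consists of the kept labels at the levels that f owns. *)
  pose U : set (nat * nat) := [set nk | own nk.1 = Some f /\ Some nk \in s nk.1.+1].
  have UL : large f U.
    have [n1 n1P] := own2 f Df; exists 1%N, n1 => n n1n fn.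
    have ofn := n1P n n1n fn; have := kept n; rewrite /kept_at asboolT; last by exists f.
    move=> [X [Xs sE]]; rewrite mul1n; apply: leq_trans Xs.
    apply: (@leq_trans (size [seq i <- lvl_labels n | i \in X])); last first.
      apply: uniq_leq_size; first by rewrite filter_uniq // uniq_lvl_labels.
      by move=> i; rewrite mem_filter => /andP[].
    rewrite size_filter count_map -!size_filter.
    apply: uniq_leq_size; rewrite ?filter_uniq ?iota_uniq // => k.
    rewrite !mem_filter => /andP[/asboolP nU kn]; rewrite kn andbT /=.
    apply/negPn/negP => kX; apply: nU; split => //=.
    by rewrite sE mem_cat mem_filter kX map_f.
  have LP := large_filter f.
  have LU := large_block_ultra (filterI UL (large_level f n0)).
  apply: (@filterS _ (block_ultra f) _ _ _ _ (LU _)) => -[n k] [[/= fn nks] n0n] /=.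
  have := bound _ _ _ fn nks.
  rewrite -ler_pdivlMl ?ltr0n // => H.
  rewrite -(ltr_pXn2r (n := 2)) ?nnegrE // ?(ltW e0) //.
  apply: le_lt_trans H _; have := n0P n n0n.
  by rewrite ltr_pdivlMr.
by exists g; split => //; rewrite gE.
Qed.

(** * Dissociated subsequences *)

Lemma seq_choice (T : Type) (P : seq T -> T -> Prop) :
  (forall s, exists x, P s x) -> exists u : nat -> T, forall k, P (mkseq u k) (u k).
Proof.
move=> /choice[g gP]; pose s := fix s n := if n is m.+1 then rcons (s m) (g (s m)) else [::].
exists (fun k => g (s k)) => k.
have -> : mkseq (fun k => g (s k)) k = s k; last exact: gP.
by elim: k => [|k IH] //; rewrite mkseqS IH.
Qed.

Definition fresh (V : zmodType) (y : nat -> V) (j b : nat) :=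
  forall c d e, (forall i, c i < b /\ d i < b)%N -> (0 < e < b)%N ->
    \sum_(i <- iota 0 j) y i *+ c i + y j *+ e <> \sum_(i <- iota 0 j) y i *+ d i.

Lemma big_uniq_sub (V : zmodType) (I : eqType) (r s : seq I) (F : I -> V) :
  uniq r -> uniq s -> {subset r <= s} ->
  \sum_(i <- r) F i = \sum_(i <- s) if i \in r then F i else 0.
Proof.
move=> ur us rs; rewrite -big_mkcond -big_filter; apply: perm_big.
apply: uniq_perm => //; first exact: filter_uniq.
by move=> i; rewrite mem_filter andb_idr //; exact: rs.
Qed.

(** Compare the coefficients at the largest index first. *)
Lemma fresh_dissociated (V : zmodType) (y : nat -> V) (b : nat) (r : seq nat) :
  uniq r -> {in r, forall j, fresh y j b} -> dissociated y (fun=> b) r.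
Proof.
have perm := permEl (perm_sort geq r); rewrite -(perm_uniq perm) => ur fr.
apply: (dissociated_perm perm).
have {fr} : {in sort geq r, forall j, fresh y j b} by move=> j; rewrite (perm_mem perm); exact: fr.
have : sorted geq (sort geq r) by apply: sort_sorted => m n; exact: leq_total.
move: (sort geq r) ur => {perm}r'; elim: r' => [|j r' IH]; first by [].
move=> /= /andP[jr ur].
rewrite (path_sortedE (rev_trans leq_trans)) => /andP[/allP jmax sr] fr c d cd.
have cd' : {in r', forall i, c i < b /\ d i < b}%N by move=> i ir; apply: cd; rewrite inE ir orbT.
have sub : {subset r' <= iota 0 j}.
  move=> i ir; rewrite mem_iota /= add0n ltn_neqAle (jmax i ir) andbT.
  by apply: contra jr => /eqP <-.
pose z (e : nat -> nat) i := if i \in r' then e i else 0%N.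
have zS e : \sum_(i <- r') y i *+ e i = \sum_(i <- iota 0 j) y i *+ z e i.
  rewrite (big_uniq_sub _ ur (iota_uniq _ _) sub); apply: eq_bigr => i _.
  by rewrite /z; case: ifP.
have [cj dj] := cd j (mem_head _ _).
have b0 : (0 < b)%N by apply: leq_ltn_trans cj.
have zb e : {in r', forall i, e i < b}%N -> forall i, (z e i < b)%N.
  by move=> eb i; rewrite /z; case: ifP => // /eb.
have zc := zb c (fun i ir => (cd' i ir).1).
have zd := zb d (fun i ir => (cd' i ir).2).
have no (e e' : nat -> nat) : (forall i, z e i < b)%N -> (forall i, z e' i < b)%N ->
    (e j < b)%N -> (e' j < e j)%N ->
    y j *+ e j + \sum_(i <- r') y i *+ e i <> y j *+ e' j + \sum_(i <- r') y i *+ e' i.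
  move=> eb e'b ej e'j E; apply: (fr j (mem_head _ _) (z e) (z e') (e j - e' j)%N) => //.
    by rewrite subn_gt0 e'j (leq_ltn_trans (leq_subr _ _)).
  rewrite -!zS; apply: (addrI (y j *+ e' j)); rewrite -E addrCA -mulrnDr subnKC 1?ltnW //.
  by rewrite addrC.
rewrite !big_cons => E; have [lt|gt|eq] := ltngtP (c j) (d j).
- by case: (no d c).
- by case: (no c d).
- have {}E : \sum_(i <- r') y i *+ c i = \sum_(i <- r') y i *+ d i.
    by apply: (addrI (y j *+ c j)); rewrite E eq.
  move=> i; rewrite inE => /orP[/eqP -> //|ir].
  by apply: (IH ur sr _ c d cd' E) => // k kr; apply: fr; rewrite inE kr orbT.
Qed.

Lemma mulrn_fct_inj (X : Type) (e : nat) (g h : X -> int) :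
  (0 < e)%N -> g *+ e = h *+ e -> g = h.
Proof.
move=> e0 E; apply/funext => x.
have app (k : X -> int) : (k *+ e) x = k x *+ e.
  by elim: (e) => [|m IH]; rewrite ?mulr0n // !mulrS -IH.
have := congr1 (@^~ x) E; rewrite !app => /eqP.
by rewrite eqr_pMn2r // => /eqP.
Qed.

(** Each of the finitely many equations that x must avoid has at most one
    solution as the group is torsion-free, and w eventually leaves it. *)
Lemma exists_fresh (X : Type) (w : nat -> X -> int) (b : nat) (s : seq nat) :
    (forall g, exists K, forall k, (K <= k)%N -> w k <> g) ->
  exists x, (size s <= x)%N /\
    fresh (fun j => w (nth 0%N (rcons s x) j)) (size s) b.
Proof.
move=> winf; pose y j := w (nth 0%N s j); pose L := box y (fun=> b) (iota 0 (size s)).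
have /choice[K KP] : forall t : (X -> int) * (X -> int) * nat, exists K,
    forall k, (K <= k)%N -> (0 < t.2)%N -> t.1.1 + w k *+ t.2 <> t.1.2.
  move=> [[p p'] e] /=; have [[g [e0 gE]]|no] := pselect (exists g, (0 < e)%N /\ p + g *+ e = p').
    have [K KP] := winf g; exists K => k Kk _ E; apply: (KP k Kk).
    by apply: (mulrn_fct_inj e0); apply: (addrI p); rewrite E.
  by exists 0%N => k _ e0 E; apply: no; exists (w k).
pose x := maxn (size s) (\max_(p <- L) \max_(p' <- L) \max_(e < b) K (p, p', val e)).
exists x; split; first exact: leq_maxl.
have yE e : \sum_(i <- iota 0 (size s)) w (nth 0%N (rcons s x) i) *+ e i =
    \sum_(i <- iota 0 (size s)) y i *+ e i.
  apply: eq_big_seq => i; rewrite mem_iota /= add0n => is_.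
  by rewrite nth_rcons is_.
move=> c d e cd /andP[e0 eb]; rewrite !yE nth_rcons ltnn eqxx.
have inL g : (forall i, g i < b)%N -> \sum_(i <- iota 0 (size s)) y i *+ g i \in L.
  by move=> gb; apply/mem_boxP; [exact: iota_uniq|exists g].
set p := \sum_(i <- _) _ *+ c i; set p' := \sum_(i <- _) _ *+ d i.
have pL : p \in L by apply: inL => i; case: (cd i).
have p'L : p' \in L by apply: inL => i; case: (cd i).
apply: (KP (p, p', e)) => //=.
apply: leq_trans (leq_maxr _ _).
apply: leq_trans (leq_bigmax_seq p pL isT).
apply: leq_trans (leq_bigmax_seq p' p'L isT).
exact: (leq_bigmax (Ordinal eb)).
Qed.

Definition level_of (j : nat) : nat :=
  if (unpickle j : option (nat * nat)) is Some (n, _) then n else 0%N.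

(** A single fast subsequence u, whose index set is split into levels by
    pairing. *)
Lemma exists_dissociated_block (w : nat -> term) :
    (forall g, exists K, forall k, (K <= k)%N -> vec (w k) <> g) ->
  exists (f : block) (h : nat -> nat -> nat), [/\ dissociated_block f,
    forall n k, f n k = w (h n k) &
    forall N, exists n0, forall n k, (n0 <= n)%N -> (N <= h n k)%N].
Proof.
move=> winf.
pose b j := (2 * lvl_bound (level_of j))%N.
have [u uP] := @seq_choice nat (fun s x => (size s <= x)%N /\
   fresh (fun j => vec (w (nth 0%N (rcons s x) j))) (size s) (b (size s)))
  (fun s => exists_fresh (b (size s)) s winf).
pose y j := vec (w (u j)).
have yf j : fresh y j (b j).
  have [_] := uP j; rewrite size_mkseq => fj c d e cd eb.
  have nthE i : (i <= j)%N -> nth 0%N (rcons (mkseq u j) (u j)) i = u i.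
    move=> ij; rewrite nth_rcons size_mkseq; case: ltngtP ij => // [ij _|-> _ //].
    by rewrite nth_mkseq.
  have yE g : \sum_(i <- iota 0 j) y i *+ g i =
      \sum_(i <- iota 0 j) vec (w (nth 0%N (rcons (mkseq u j) (u j)) i)) *+ g i.
    by apply: eq_big_seq => i; rewrite mem_iota /= add0n => /ltnW /nthE ->.
  rewrite !yE; have := fj c d e cd eb; rewrite [X in _ + vec (w X) *+ e]nthE //.
have uj j : (j <= u j)%N by have [] := uP j; rewrite size_mkseq.
pose h (n k : nat) := u (pickle (n, k)).
exists (fun n k => w (h n k)), h; split => // [n|N].
- have inj : injective (fun k : nat => pickle (n, k)) by move=> k l /(pcan_inj pickleK)[].
  have dis : dissociated y (fun=> (2 * lvl_bound n)%N)
      [seq pickle (n, k) | k <- iota 0 (lvl_size n)].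
    apply: fresh_dissociated; first by rewrite map_inj_uniq ?iota_uniq.
    move=> _ /mapP[k _ ->]; have := yf (pickle (n, k)).
    by rewrite /b /level_of pickleK.
  move=> c d cd E.
  pose z (e : nat -> nat) (j : nat) :=
    if (unpickle j : option (nat * nat)) is Some (_, k) then e k else 0%N.
  have zE e k : z e (pickle (n, k)) = e k by rewrite /z pickleK.
  move=> k kn; rewrite -(zE c) -(zE d); apply: dis; last by apply/mapP; exists k.
    by move=> _ /mapP[l ln ->]; rewrite !zE; exact: cd.
  rewrite !big_map (eq_bigr (fun k => vec (w (h n k)) *+ c k)); last first.
    by move=> l _; rewrite zE.
  by rewrite E; apply: eq_bigr => l _; rewrite zE.
- exists (\max_(j < N) level_of j).+1 => n k nn; rewrite leqNgt; apply/negP => hN.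
  have pN : (pickle (n, k) < N)%N by apply: leq_ltn_trans hN.
  move: nn; rewrite ltnNge => /negP; apply.
  have := leq_bigmax (F := fun j : 'I_N => level_of j) (Ordinal pN).
  by rewrite /level_of /= pickleK.
Qed.

(** * The semigroup and its topology *)

(** [Bic n m] tags the element p^n q^m, [Int z] the limit of the fibre over z,
    and [Far] the points of the ideal Y. *)
Inductive tag := Bic of nat & nat | Int of int | Far.
HB.instance Definition _ := gen_eqMixin tag.
HB.instance Definition _ := gen_choiceMixin tag.

Definition fibre (s : tag) : option int :=
  match s with
  | Bic n m => Some (n%:Z - m%:Z) | Int z => Some z | Far => None
  end.

Definition bic_mul (x y : nat * nat) : nat * nat :=
  (x.1 + (y.1 - x.2), y.2 + (x.2 - y.1))%N.

Definition tag_mul (s t : tag) : tag :=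
  match s, t with
  | Bic n m, Bic n' m' =>
      Bic (bic_mul (n, m) (n', m')).1 (bic_mul (n, m) (n', m')).2
  | Far, _ | _, Far => Far
  | Int z, Int z' => Int (z + z')
  | Bic n m, Int z => Int (n%:Z - m%:Z + z)
  | Int z, Bic n m => Int (z + (n%:Z - m%:Z))
  end.

Lemma tag_mulA : associative tag_mul.
Proof.
move=> [n m|z|] [n' m'|z'|] [n'' m''|z''|] //=; rewrite /bic_mul /=;
  by [congr Bic; lia|congr Int; lia].
Qed.

Lemma fibre_mul s t : fibre (tag_mul s t) =
  if (fibre s, fibre t) is (Some a, Some b) then Some (a + b) else None.
Proof. by case: s t => [n m|z|] [n' m'|z'|] //=; congr Some; rewrite /bic_mul /=; lia. Qed.

Definition character (C : numClosedFieldType) := {a : coord -> C | admissible a}.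

HB.instance Definition _ (C : numClosedFieldType) := gen_eqMixin (character C).

Definition ev (C : numClosedFieldType) (t : term) (a : character C) : C :=
  eval (sval a) t.

Definition point_ok (C : numClosedFieldType) (x : tag * (character C -> C)) : Prop :=
  if fibre x.1 is Some z then x.2 = @ev C (tint z)
  else exists2 t, top_blocks t <> [::] & x.2 = @ev C t.

(** A point consists of its tag and of its values at all the admissible
    characters; the tag of a point of Y carries no information, so that terms
    with equal values are identified. *)
Definition bic_space (C : numClosedFieldType) := {x : tag * (character C -> C) | point_ok x}.

HB.instance Definition _ (C : numClosedFieldType) := gen_eqMixin (bic_space C).
HB.instance Definition _ (C : numClosedFieldType) := gen_choiceMixin (bic_space C).

Lemma point_inj (C : numClosedFieldType) (x y : bic_space C) : sval x = sval y -> x = y.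
Proof. by case: x y => [x xP] [y yP] /= xy; subst y; congr exist; exact: Prop_irrelevance. Qed.

Definition tag_of (C : numClosedFieldType) (x : bic_space C) : tag := (sval x).1.
Definition val_of (C : numClosedFieldType) (x : bic_space C) : character C -> C := (sval x).2.

Lemma char_neq0 (C : numClosedFieldType) (a : character C) x : sval a x != 0.
Proof. by have [a1 _] := svalP a; rewrite -normr_eq0 a1 oner_eq0. Qed.

Lemma ev_add (C : numClosedFieldType) (s t : term) (a : character C) :
  ev s a * ev t a = ev (tadd s t) a.
Proof. by []. Qed.

Lemma ev_tint (C : numClosedFieldType) (y z : int) (a : character C) :
  ev (tint y) a * ev (tint z) a = ev (tint (y + z)) a.
Proof. by rewrite /ev /= expfzDr // char_neq0. Qed.

Lemma top_blocks_tadd s t : top_blocks s <> [::] \/ top_blocks t <> [::] ->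
  top_blocks (tadd s t) <> [::].
Proof.
move=> /= st /eqP; rewrite -size_eq0 size_cat addn_eq0 !size_eq0.
by move=> /andP[/eqP sE /eqP tE]; case: st.
Qed.

Lemma point_mul_ok (C : numClosedFieldType) (x y : bic_space C) :
  @point_ok C (tag_mul (tag_of x) (tag_of y), fun a => val_of x a * val_of y a).
Proof.
have [] := (svalP x, svalP y).
rewrite /point_ok -/(tag_of x) -/(tag_of y) -/(val_of x) -/(val_of y) /= fibre_mul.
case: (fibre (tag_of x)) => [z|]; case: (fibre (tag_of y)) => [z'|].
- by move=> -> ->; apply/funext => a; exact: ev_tint.
- move=> -> [t tg ->]; exists (tadd (tint z) t) => //; apply: top_blocks_tadd; by right.
- move=> [t tg ->] ->; exists (tadd t (tint z')) => //; apply: top_blocks_tadd; by left.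
- move=> [t tg ->] [t' t'g ->]; exists (tadd t t') => //; apply: top_blocks_tadd; by left.
Qed.

Definition point_mul (C : numClosedFieldType) (x y : bic_space C) : bic_space C :=
  exist _ _ (point_mul_ok x y).

Lemma point_mulA (C : numClosedFieldType) : associative (@point_mul C).
Proof.
move=> x y z; apply: point_inj; congr pair; first exact: tag_mulA.
by apply/funext => a; exact: mulrA.
Qed.

HB.instance Definition _ (C : numClosedFieldType) :=
  isSemigroup.Build (bic_space C) (@point_mulA C).

(** The index [Bic n m] stands for the indicator of one element of the bicyclic
    monoid, [Int z] for that of the whole fibre over z, limit included; hence
    the elements of the fibre that leave the finite sets converge to the
    integer. *)
Definition tag_index (i s : tag) : bool :=
  match i with Bic _ _ => s == i | Int z => fibre s == Some z | Far => false end.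

Definition coords (C : numClosedFieldType) (x : bic_space C) (i : character C + tag) : C :=
  match i with inl a => val_of x a | inr i => (tag_index i (tag_of x))%:R end.

HB.instance Definition _ (C : numClosedFieldType) :=
  Uniform.copy (bic_space C) (initial_topology
    (@coords C : bic_space C -> prod_topology (fun _ : character C + tag => C : uniformType))).

Lemma near_fst (T : topologicalType) (x y : T) (P : set T) :
  (\forall z \near x, P z) -> \forall p \near (x, y), P p.1.
Proof. by move=> nx; exact: (cvg_fst nx). Qed.

Lemma near_snd (T : topologicalType) (x y : T) (P : set T) :
  (\forall z \near y, P z) -> \forall p \near (x, y), P p.2.
Proof. by move=> ny; exact: (cvg_snd ny). Qed.

Lemma cvg_point (C : numClosedFieldType) (F : set_system (bic_space C)) (x : bic_space C) :
  Filter F -> (forall i, (fun y : bic_space C => coords y i) @ F --> coords x i) -> F --> x.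
Proof.
move=> FF cF A [_ [[B Bop <-] Bx] BA].
pose K := fun _ : character C + tag => C : uniformType.
have cB : (fun y : bic_space C => coords y : prod_topology K) @ F --> (coords x : prod_topology K).
  apply/cvg_sup => i U [_ [[V Vop <-] Vx] VU].
  have FV := cF i V (open_nbhs_nbhs (conj Vop Vx)).
  by apply: (@filterS _ F _ _ _ _ FV) => y Vy; exact: VU.
have FB := cB B (open_nbhs_nbhs (conj Bop Bx)).
by apply: (@filterS _ F _ _ _ _ FB) => y; exact: BA.
Qed.

Lemma coord_continuous (C : numClosedFieldType) (i : character C + tag) :
  continuous (fun x : bic_space C => coords x i).
Proof.
move=> x.
pose K := fun _ : character C + tag => C : uniformType.
apply: (@cvg_comp _ _ _ (@coords C : bic_space C -> prod_topology K)
  (fun g => g i) _ (nbhs (coords x : prod_topology K))).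
  exact: (@initial_continuous (bic_space C) (prod_topology K) (@coords C) x).
exact: (@proj_continuous _ (fun _ => C : topologicalType) i (coords x)).
Qed.

Lemma hausdorff_point (C : numClosedFieldType) : hausdorff_space (bic_space C).
Proof.
move=> x y xy.
have eqc i : coords x i = coords y i.
  apply: (@norm_hausdorff _ C) => A B Ax By.
  have [z [Az Bz]] := xy _ _ (@coord_continuous C i x A Ax) (@coord_continuous C i y B By).
  by exists (coords z i).
have vE : val_of x = val_of y by apply/funext => a; exact: (eqc (inl a)).
have tE i : tag_index i (tag_of x) = tag_index i (tag_of y).
  have := eqc (inr i); rewrite /coords.
  by case: (tag_index i _) (tag_index i _) => -[] // /eqP; rewrite ?oner_eq0 // eq_sym oner_eq0.
have fE : fibre (tag_of x) = fibre (tag_of y).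
  have fE z := tE (Int z); rewrite /= in fE.
  case E : (fibre (tag_of x)) => [z|]; first by have := fE z; rewrite E eqxx => /esym/eqP.
  by case E' : (fibre (tag_of y)) => [z|] //; have := fE z; rewrite E E' eqxx.
suff : tag_of x = tag_of y.
  move=> tg; apply: point_inj.
  by rewrite (surjective_pairing (sval x)) (surjective_pairing (sval y)); congr pair.
case Ex : (tag_of x) fE (tE (tag_of x)) (tE (tag_of y)) => [n m|z|];
  case Ey : (tag_of y) => [n' m'|z'|] //=.
- by move=> _; rewrite eqxx => /esym/eqP.
- by move=> _; rewrite eqxx => /esym/eqP.
- by move=> _ _; rewrite eqxx => /eqP.
- by move=> [->].
Qed.

Lemma near_tag_index (C : numClosedFieldType) (x : bic_space C) (i : tag) :
  \forall y \near x, tag_index i (tag_of y) = tag_index i (tag_of x).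
Proof.
have /cvgrPdist_lt/(_ 1 ltr01) := @coord_continuous C (inr i) x.
apply: filterS => y /=.
by case: (tag_index i _) (tag_index i _) => -[]; rewrite ?subr0 ?sub0r ?normrN ?normr1 ?ltxx.
Qed.

Lemma separation_tint (C : numClosedFieldType) (t : term) (z : int) :
    compact [set z : C | `|z| <= 1] -> top_blocks t <> [::] ->
  exists a : character C, ev t a <> ev (tint z) a.
Proof.
move=> cpt tg; have tg' := @top_blocks_tadd t (tint (- z)) (or_introl tg).
have [a [aA ne1]] := separation cpt tg'.
exists (exist _ a aA) => E; apply: ne1.
have := ev_add t (tint (- z)) (exist _ a aA); rewrite E ev_tint subrr /ev /= => <-.
by rewrite expr0z.
Qed.

Lemma val_of_fibre (C : numClosedFieldType) (x : bic_space C) (z : int) :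
  fibre (tag_of x) = Some z -> val_of x = @ev C (tint z).
Proof. by have := svalP x; rewrite /point_ok -/(tag_of x) => /[swap] ->. Qed.

Lemma val_of_far (C : numClosedFieldType) (x : bic_space C) :
  fibre (tag_of x) = None -> exists2 t, top_blocks t <> [::] & val_of x = @ev C t.
Proof. by have := svalP x; rewrite /point_ok -/(tag_of x) => /[swap] ->. Qed.

Lemma tag_of_mul (C : numClosedFieldType) (x y : bic_space C) :
  tag_of (x * y)%g = tag_mul (tag_of x) (tag_of y).
Proof. by []. Qed.

Lemma cvg_val_mul (C : numClosedFieldType) (x y : bic_space C) (a : character C) :
  (fun p : bic_space C * bic_space C => val_of (p.1 * p.2)%g a) @ nbhs (x, y) --> val_of (x * y)%g a.
Proof.
have c1 : (fun p : bic_space C * bic_space C => val_of p.1 a) @ nbhs (x, y) --> val_of x a.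
  exact: (cvg_comp (fun p : bic_space C * bic_space C => p.1) (fun z : bic_space C => coords z (inl a))
    cvg_fst (@coord_continuous C (inl a) x)).
have c2 : (fun p : bic_space C * bic_space C => val_of p.2 a) @ nbhs (x, y) --> val_of y a.
  exact: (cvg_comp (fun p : bic_space C * bic_space C => p.2) (fun z : bic_space C => coords z (inl a))
    cvg_snd (@coord_continuous C (inl a) y)).
exact: (cvgM c1 c2).
Qed.

(** When a factor lies in Y so does the product, and a character separates it
    from z; nearby products are separated from z by the same character. *)
Lemma near_fibre_mul (C : numClosedFieldType) (x y : bic_space C) (z : int) :
    compact [set z : C | `|z| <= 1] ->
  \forall p \near (x, y), (fibre (tag_of (p.1 * p.2)%g) == Some z) =
    (fibre (tag_of (x * y)%g) == Some z).
Proof.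
move=> cpt; case Exy : (fibre (tag_of (x * y)%g)) => [b|].
  move: Exy; rewrite tag_of_mul fibre_mul.
  case Ex : (fibre (tag_of x)) => [c|//]; case Ey : (fibre (tag_of y)) => [d|//] [<-].
  have nx := near_tag_index x (Int c); have ny := near_tag_index y (Int d).
  rewrite /= Ex Ey !eqxx in nx ny.
  apply: filterS (filterI (near_fst y nx) (near_snd x ny)) => p [/=].
  by move=> /eqP pc /eqP pd; rewrite tag_of_mul fibre_mul pc pd.
have [t tg tE] := val_of_far Exy.
have [a ne] := separation_tint z cpt tg; rewrite -tE in ne.
have pos : 0 < `|val_of (x * y)%g a - ev (tint z) a|.
  by rewrite normr_gt0 subr_eq0; exact/eqP.
have /cvgrPdist_lt/(_ _ pos) := @cvg_val_mul C x y a.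
apply: filterS => p pc; apply/negbTE/negP => /eqP/val_of_fibre pE.
by move: pc; rewrite pE ltxx.
Unshelve. all: by end_near.
Qed.

(** In a fixed fibre, only finitely many elements have a bounded exponent. *)
Lemma near_Int (C : numClosedFieldType) (x : bic_space C) (z : int) (N : nat) :
  tag_of x = Int z ->
  \forall y \near x, tag_of y = Int z \/
    exists n m, [/\ tag_of y = Bic n m, (N < n)%N & (N < m)%N].
Proof.
(* If n - m = z and one of n, m is at most N, both are below K. *)
move=> xz; pose K := (N + `|z|).+1%N.
have nz := near_tag_index x (Int z).
have nb : \forall y \near x, forall ij : 'I_K * 'I_K, tag_of y != Bic ij.1 ij.2.
  apply: (@filter_forall _ _ (fun ij : 'I_K * 'I_K =>
    [set y : bic_space C | tag_of y != Bic ij.1 ij.2]) (nbhs x)) => ij.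
  have := near_tag_index x (Bic ij.1 ij.2).
  by apply: filterS => y /= ->; rewrite xz; apply/eqP.
rewrite /= xz eqxx in nz; apply: filterS (filterI nz nb) => y [/eqP] /=.
case: (tag_of y) => [n m|z'|] //= [E] nK; last by left; rewrite E.
right; exists n, m; split => //; rewrite ltnNge; apply/negP => le.
  have [nK' mK] : (n < K)%N /\ (m < K)%N by rewrite /K; lia.
  by have := nK (Ordinal nK', Ordinal mK); rewrite /= eqxx.
have [nK' mK] : (n < K)%N /\ (m < K)%N by rewrite /K; lia.
by have := nK (Ordinal nK', Ordinal mK); rewrite /= eqxx.
Qed.

(** In (p^i q^j) (p^k q^l) the exponent of p is at least i and the exponent of q
    at least l.  So a left factor near an integer, or a right factor near an
    integer, makes an exponent of the product too large. *)
Lemma near_Bic_mul (C : numClosedFieldType) (x y : bic_space C) (n m : nat) :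
    compact [set z : C | `|z| <= 1] ->
  \forall p \near (x, y), (tag_of (p.1 * p.2)%g == Bic n m) =
    (tag_of (x * y)%g == Bic n m).
Proof.
move=> cpt; have nf := near_fibre_mul x y (n%:Z - m%:Z) cpt.
have FF : Filter (nbhs (x, y)) by exact: filter_prod_filter.
have [ne|] := boolP (fibre (tag_of (x * y)%g) != Some (n%:Z - m%:Z)).
  rewrite (negbTE ne) in nf; apply: filterS nf => p /eqP pE.
  by apply/eqP/eqP => E; [case: pE|move/eqP: ne => ne; case: ne]; rewrite E.
rewrite negbK tag_of_mul fibre_mul => /eqP.
case Ex : (fibre (tag_of x)) => [a|//]; case Ey : (fibre (tag_of y)) => [b|//] [ab].
have nx := near_tag_index x (Int a); have ny := near_tag_index y (Int b).
rewrite /= Ex Ey !eqxx in nx ny.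
have nxy := @filterI _ _ FF _ _ (near_fst y nx) (near_snd x ny).
case Ty : (tag_of y) Ey => [k l|z|] //= Ey; last first.
  have nyz : nbhs (x, y) _ := near_snd x (near_Int m Ty).
  apply: filterS (filterI nxy nyz) => p [[/= fp _]].
  rewrite tag_of_mul => gp; transitivity false; last by case: (tag_of x) => *; apply/esym/negbTE/eqP.
  apply/negbTE/eqP; case: gp => [->|[n' [m' [-> _ mm']]]]; first by case: (tag_of p.1).
  by case: (tag_of p.1) => //= i j [_ mE]; move: mm'; rewrite -mE /bic_mul /=; lia.
have nyk : nbhs (x, y) _ := near_snd x (near_tag_index y (Bic k l)); rewrite /= Ty eqxx in nyk.
case Tx : (tag_of x) Ex => [i j|z|] //= Ex; last first.
  have nxz : nbhs (x, y) _ := near_fst y (near_Int n Tx).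
  apply: filterS (filterI nyk nxz) => p [/= /eqP pk].
  rewrite tag_of_mul pk => gp; transitivity false; last by apply/esym/negbTE/eqP.
  apply/negbTE/eqP; case: gp => [->//|[n' [m' [-> nn' _]]]] /= [nE _].
  by move: nn'; rewrite -nE /bic_mul /=; lia.
have nxi : nbhs (x, y) _ := near_fst y (near_tag_index x (Bic i j)); rewrite /= Tx eqxx in nxi.
by apply: filterS (filterI nyk nxi) => p [/= /eqP pk /eqP pi]; rewrite tag_of_mul pk pi.
Qed.

Lemma point_mul_continuous (C : numClosedFieldType) :
    compact [set z : C | `|z| <= 1] ->
  continuous (fun x : bic_space C * bic_space C => x.1 * x.2)%g.
Proof.
move=> cpt [x y]; apply: cvg_point => -[a|i]; first exact: cvg_val_mul.
apply: cvg_near_cst; case: i => [n m|z|].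
- apply: filterS (near_Bic_mul x y n m cpt) => p pE.
  exact: (congr1 (fun b : bool => b%:R : C) pE).
- apply: filterS (near_fibre_mul x y z cpt) => p pE.
  exact: (congr1 (fun b : bool => b%:R : C) pE).
- exact: nearW.
Qed.

(** * Countable compactness and the copy of the bicyclic monoid *)

Definition along (E : set nat) : set_system nat :=
  [set A | exists N, forall k, (N <= k)%N -> E k -> A k].

Lemma along_filter (E : set nat) : (forall N, exists2 k, (N <= k)%N & E k) ->
  ProperFilter (along E).
Proof.
move=> Einf; split; first by move=> [N H]; have [k Nk Ek] := Einf N; exact: (H k).
split; first by exists 0%N.
- move=> A B [N HA] [M HB]; exists (maxn N M) => k; rewrite geq_max => /andP[Nk Mk] Ek.
  by split; [exact: HA|exact: HB].
- by move=> A B AB [N HA]; exists N => k Nk Ek; apply: AB; exact: HA.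
Qed.

Lemma eventually_along (E : set nat) : \oo `<=` along E.
Proof. by move=> A [N _ NA]; exists N => k Nk _; exact: NA. Qed.

Lemma coords_Bic_neq (C : numClosedFieldType) (x : bic_space C) n m :
  tag_of x <> Bic n m -> coords x (inr (Bic n m)) = 0.
Proof. by move=> /eqP/negbTE; rewrite /coords /tag_index => ->. Qed.

Lemma coords_Int_neq (C : numClosedFieldType) (x : bic_space C) z :
  fibre (tag_of x) <> Some z -> coords x (inr (Int z)) = 0.
Proof. by move=> /eqP/negbTE; rewrite /coords /tag_index => ->. Qed.

(** Unless a value is repeated infinitely often, either infinitely many points
    have the same vector, and then they move to infinity in one fibre, or the
    sequence of vectors is finite-to-one and has a dissociated subsequence f,
    with cluster point [tlim f]. *)
Lemma point_seq_cluster (C : numClosedFieldType) (s : nat -> bic_space C) :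
  exists (x : bic_space C) (G : set_system nat),
    [/\ ProperFilter G, \oo `<=` G & s @ G --> x].
Proof.
have [[x xinf]|/forallNP fin] := pselect (exists x, forall N, exists2 k, (N <= k)%N & s k = x).
  have GP := along_filter xinf; exists x, (along [set k | s k = x]); split => //.
    exact: eventually_along.
  by apply: cvg_near_cst; exists 0%N.
have {}fin x : exists K, forall k, (K <= k)%N -> s k <> x.
  apply: contrapT => /forallNP H; apply: (fin x) => N; apply: contrapT => H'.
  by apply: (H N) => k Nk skx; apply: H'; exists k.
have /choice[t tP] : forall k, exists t : term, val_of (s k) = @ev C t /\
    if fibre (tag_of (s k)) is Some z then t = tint z else True.
  move=> k; case E : (fibre (tag_of (s k))) => [z|]; last first.
    by have [t _ tE] := val_of_far E; exists t.
  by exists (tint z); split => //; exact: val_of_fibre.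
have evE k l : vec (t k) = vec (t l) -> val_of (s k) = val_of (s l).
  move=> kl; rewrite (tP k).1 (tP l).1; apply/funext => a.
  by apply: eq_vec_eval => //; case: (svalP a).
have fib_vec k z : fibre (tag_of (s k)) = Some z -> vec (t k) = vec (tint z).
  by move=> kz; have [_] := tP k; rewrite kz => ->.
have [[g ginf]|/forallNP vfin] :=
    pselect (exists g, forall N, exists2 k, (N <= k)%N & vec (t k) = g).
  have [K KP] : exists K, forall k, (K <= k)%N -> vec (t k) = g ->
      exists z, fibre (tag_of (s k)) = Some z.
    have [[k0 k0g k0F]|no] := pselect (exists2 k0, vec (t k0) = g & tag_of (s k0) = Far).
      have [K KP] := fin (s k0); exists K => k Kk kg.
      case Ek : (tag_of (s k)) => [n m|z|]; [by exists (n%:Z - m%:Z)|by exists z|].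
      exfalso; apply: (KP k Kk); apply: point_inj.
      rewrite (surjective_pairing (sval (s k))) (surjective_pairing (sval (s k0))).
      congr pair; first by rewrite -/(tag_of (s k)) -/(tag_of (s k0)) Ek k0F.
      by apply: evE; rewrite kg k0g.
    exists 0%N => k _ kg; case Ek : (tag_of (s k)) => [n m|z|].
    - by exists (n%:Z - m%:Z).
    - by exists z.
    - by case: no; exists k.
  have [k0 Kk0 k0g] := ginf K; have [z k0z] := KP k0 Kk0 k0g.
  have KPz k : (K <= k)%N -> vec (t k) = g -> fibre (tag_of (s k)) = Some z.
    move=> Kk kg; have [z' kz'] := KP k Kk kg; rewrite kz'.
    have := congr1 (@^~ None) (etrans (esym (fib_vec _ _ kz'))
      (etrans kg (etrans (esym k0g) (fib_vec _ _ k0z)))).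
    by rewrite /= => ->.
  have xok : @point_ok C (Int z, @ev C (tint z)) by [].
  have xB n m : tag_of (exist _ _ xok) <> Bic n m by [].
  have GP := along_filter ginf.
  exists (exist _ _ xok), (along [set k | vec (t k) = g]); split => //.
    exact: eventually_along.
  apply: cvg_point => -[a|[n m|z'|]]; apply: cvg_near_cst.
  - exists K => k Kk kg; exact: (congr1 (@^~ a) (val_of_fibre (KPz k Kk kg))).
  - have [[k1 k1n]|no] := pselect (exists k1, tag_of (s k1) = Bic n m); last first.
      exists 0%N => k _ _; rewrite (coords_Bic_neq (xB n m)); apply: coords_Bic_neq => E.
      by apply: no; exists k.
    have [K' K'P] := fin (s k1); exists K' => k K'k kg.
    rewrite (coords_Bic_neq (xB n m)); apply: coords_Bic_neq => E.
    apply: (K'P k K'k); apply: point_inj.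
    rewrite (surjective_pairing (sval (s k))) (surjective_pairing (sval (s k1))).
    congr pair; first by rewrite -/(tag_of (s k)) -/(tag_of (s k1)) E k1n.
    rewrite -/(val_of (s k)) -/(val_of (s k1)).
    by rewrite (@val_of_fibre _ _ (n%:Z - m%:Z)) ?E // (@val_of_fibre _ _ (n%:Z - m%:Z)) ?k1n.
  - exists K => k Kk kg.
    exact: (congr1 (fun o : option int => (o == Some z')%:R : C) (KPz k Kk kg)).
  - by exists 0%N.
have {}vfin g : exists K, forall k, (K <= k)%N -> vec (t k) <> g.
  apply: contrapT => /forallNP H; apply: (vfin g) => N; apply: contrapT => H'.
  by apply: (H N) => k Nk skx; apply: H'; exists k.
have [f [h [fg fh hinf]]] := exists_dissociated_block vfin.
have xok : @point_ok C (Far, @ev C (tlim f)) by exists (tlim f).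
have xB n m : tag_of (exist _ _ xok) <> Bic n m by [].
have xI z : fibre (tag_of (exist _ _ xok)) <> Some z by [].
pose G := (fun nk : nat * nat => h nk.1 nk.2) @ block_ultra f.
have BP := block_ultra_proper f.
have GP : ProperFilter G by exact: fmap_proper_filter.
have Goo : \oo `<=` G.
  move=> A [N _ NA]; have [n0 n0P] := hinf N.
  apply: (@filterS _ (block_ultra f) _ _ _ _ (large_block_ultra (large_level f n0))).
  by move=> [n k] /= n0n; apply: NA; exact: n0P.
exists (exist _ _ xok), G; split => //.
apply: cvg_point => -[a|i].
  have [a1 aP] := svalP a; have := aP f fg.
  rewrite (_ : (fun nk : nat * nat => _) =
     (fun y => coords y (inl a)) \o (fun nk : nat * nat => s (h nk.1 nk.2))) //.
  by apply/funext => nk; rewrite /= (tP _).1 fh.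
suff H : \oo [set k | coords (s k) (inr i) = coords (exist _ _ xok) (inr i)].
  by apply: cvg_near_cst; exact: (Goo _ H).
have nofib z : exists K, forall k, (K <= k)%N -> fibre (tag_of (s k)) <> Some z.
  by have [K KP] := vfin (vec (tint z)); exists K => k Kk /fib_vec; exact: KP.
case: i => [n m|z|].
- have [K KP] := nofib (n%:Z - m%:Z); exists K => // k Kk; rewrite /mkset.
  by rewrite (coords_Bic_neq (xB n m)); apply: coords_Bic_neq => E; apply: (KP k Kk); rewrite E.
- have [K KP] := nofib z; exists K => // k Kk; rewrite /mkset.
  by rewrite (coords_Int_neq (xI z)); apply: coords_Int_neq; exact: KP.
- by exists 0%N.
Qed.

Lemma seq_cluster_countably_compact (T : topologicalType) :
    (forall s : nat -> T, exists (x : T) (G : set_system nat),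
      [/\ ProperFilter G, \oo `<=` G & s @ G --> x]) ->
  countably_compact [set: T].
Proof.
move=> cl J D f cD fo cov.
have /countable_injP[g gD] := cD.
apply: contrapT => nfin.
have miss (n : nat) : exists x : T, forall i, D i -> (g i <= n)%N -> ~ f i x.
  apply: contrapT => /forallNP H; apply: nfin.
  pose Dn := D `&` [set i | g i <= n]%N.
  have finD : finite_set Dn.
    have gDn : {in Dn &, injective g}.
      by move=> i j /set_mem[Di _] /set_mem[Dj _]; apply: gD; exact: mem_set.
    rewrite -(eq_finite_set (inj_card_eq gDn)).
    by apply: sub_finite_set (finite_II n.+1) => _ [i [_ /= gi] <-]; rewrite /= ltnS.
  exists (fset_set Dn) => [i|]; first by rewrite in_fset_set // => /set_mem[Di _]; exact: mem_set.
  rewrite fset_setK // => x _; have [i Di fix_] := cov x I.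
  apply: contrapT => nx; apply: (H x) => j Dj gj fj; apply: nx.
  by exists j.
have /choice[s sP] := miss.
have [x [G [GP Goo sx]]] := cl s.
have [i Di fix_] := cov x I.
have Gi : G [set k | f i (s k)] by apply: sx; apply: open_nbhs_nbhs; split => //; exact: fo.
have Gk : G [set k | g i <= k]%N by apply: Goo; exists (g i).
have [k [/= fk gk]] := @filter_ex _ _ GP _ (filterI Gi Gk).
exact: (sP k i Di gk fk).
Qed.

Lemma tychonoff_point (C : numClosedFieldType) : tychonoff_space (bic_space C).
Proof.
split; last exact: hausdorff_point.
exact: (@uniform_completely_regular Rdefinitions.R (bic_space C : uniformType)).
Qed.

Lemma bic_point_ok (C : numClosedFieldType) (nm : nat * nat) :
  @point_ok C (Bic nm.1 nm.2, @ev C (tint (nm.1%:Z - nm.2%:Z))).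
Proof. by []. Qed.

Definition bic_point (C : numClosedFieldType) (nm : nat * nat) : bic_space C :=
  exist _ _ (bic_point_ok C nm).

Lemma bic_pointM (C : numClosedFieldType) (x y : nat * nat) :
  bic_point C (bic_mul x y) = (bic_point C x * bic_point C y)%g.
Proof.
apply: point_inj; case: x y => [n m] [n' m']; congr pair.
apply/funext => a; rewrite /= ev_tint; congr (ev (tint _) a).
by rewrite /bic_mul /=; lia.
Qed.

(** The pair (n, m) of the normal form p^n q^m. *)
Definition bicyclic_exponents (x : bicyclic) : nat * nat :=
  foldr bicyclic_act (0, 0)%N (repr x).

Lemma bicyclic_exponents_pi (u : bicyclic_word) :
  bicyclic_exponents (bicyclic_pi u) = foldr bicyclic_act (0, 0)%N u.
Proof.
apply: bicyclic_act_cong; apply/eq_bicyclicP.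
by rewrite /bicyclic_pi reprK.
Qed.

Lemma bicyclic_exponentsM (x y : bicyclic) :
  bicyclic_exponents (x * y)%g = bic_mul (bicyclic_exponents x) (bicyclic_exponents y).
Proof.
have [u ->] := bicyclic_piP x; have [w ->] := bicyclic_piP y.
rewrite -bicyclic_piM !bicyclic_exponents_pi foldr_cat.
move: (foldr _ _ w) => z; elim: u => [|a u IH] /=.
  by case: z => n m; rewrite /bic_mul /=; congr pair; lia.
rewrite IH; case: (foldr _ _ u) z {IH} => [n m] [n' m'].
case: a; rewrite /bic_mul /=; first by congr pair; lia.
by case: n => [|n] /=; case E : (_ + _)%N => [|k]; congr pair; lia.
Qed.

Lemma bicyclic_exponents_inj : injective bicyclic_exponents.
Proof.
suff H x : x = (bicyclic_p ^+ (bicyclic_exponents x).1 *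
    bicyclic_q ^+ (bicyclic_exponents x).2)%g.
  by move=> x y xy; rewrite (H x) (H y) xy.
have [[n m] [xE _]] := bicyclic_normal_form x.
have -> : bicyclic_exponents x = (n, m); last exact: xE.
rewrite xE bicyclic_XpXq bicyclic_exponents_pi foldr_cat.
have -> : foldr bicyclic_act (0, 0)%N (nseq m letter_q) = (0%N, m) by elim: m {xE} => //= m ->.
by elim: n {xE} => //= n ->.
Qed.

Lemma bicyclic_copy_bic (C : numClosedFieldType) :
  bicyclic_copy (range (bic_point C \o bicyclic_exponents)).
Proof.
have fM : {morph bic_point C \o bicyclic_exponents : x y / (x * y)%g}.
  by move=> x y; rewrite /= bicyclic_exponentsM bic_pointM.
split.
  by move=> _ _ [x _ <-] [y _ <-]; exists (x * y)%g.
pose mix := isMultiplicative.Build bicyclic (bic_space C) _ fM.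
pose f : {multiplicative bicyclic -> bic_space C} :=
  HB.pack (bic_point C \o bicyclic_exponents) mix.
exists f; split.
- by move=> x _; exists x.
- move=> x y _ _ /(congr1 (@tag_of C)) [e1 e2]; apply: bicyclic_exponents_inj.
  by rewrite (surjective_pairing (bicyclic_exponents x)) e1 e2 -surjective_pairing.
- by move=> _ [x _ <-]; exists x.
Qed.

Theorem corollary10p2 :
  exists S : topologicalSemigroupType,
    [/\ tychonoff_space S, countably_compact [set: S] &
        exists A : set S, bicyclic_copy A].
Proof.
pose C : numClosedFieldType := complex Rdefinitions.R.
have cpt : compact [set z : C | `|z| <= 1] by exact: compact_complex_disc.
clearbody C.
pose mix := PreTopologicalSemigroup_isTopologicalSemigroup.Build (bic_space C)
  (point_mul_continuous cpt).
pose S : topologicalSemigroupType := HB.pack (bic_space C) mix.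
exists S; split.
- exact: (tychonoff_point C).
- apply: seq_cluster_countably_compact => s; exact: (@point_seq_cluster C s).
- exists (range (bic_point C \o bicyclic_exponents)); exact: (bicyclic_copy_bic C).
Qed.
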